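(* Let $\Omega\subset\mathbb{R}^n$ be a (possibly unbounded) domain, let $\mathcal{L}u=-\nabla\cdot(A\nabla u)-B\cdot\nabla u-cu$, and let $\mathcal{B}$ be either the Dirichlet or the indefinite Robin boundary operator, all satisfying the standing assumptions stated in the context. Assume in addition that $\Omega$ is uniformly $C^2$, that $B,c,\gamma$ are uniformly $C^{0,\alpha}$, that $A$ is uniformly $C^{1,\alpha}$, and that $A$ is uniformly elliptic, i.e. $A(x)\ge\underline{A}I_n$ for all $x\in\Omega$ for some constant $\underline{A}>0$. Let $$\tilde\lambda_1:=\sup\{\lambda\in\mathbb{R}:(\mathcal{L}-\lambda,\mathcal{B})\text{ admits a supersolution with positive infimum}\}.$$ If $\tilde\lambda_1>0$, then $(\mathcal{L},\mathcal{B})$ satisfies the Maximum Principle in $\Omega$.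
   Context: Operators. $\mathcal{L}u(x)=-\nabla\cdot(A(x)\nabla u(x))-B(x)\cdot\nabla u(x)-c(x)u(x)$ for $x\in\Omega$, with $A:\Omega\to\mathbb{R}^{n\times n}$, $B:\Omega\to\mathbb{R}^n$, $c:\Omega\to\mathbb{R}$. The boundary operator $\mathcal{B}$ on $\partial\Omega$ is either of Dirichlet type, $\mathcal{B}u(x)=u(x)$, or of indefinite Robin type, $\mathcal{B}u(x)=\nu(x)\cdot A(x)\nabla u(x)+\gamma(x)u(x)$, where $\nu$ is the outer unit normal and $\gamma:\partial\Omega\to\mathbb{R}$ has no sign restriction (Neumann is $\gamma\equiv0$). Standing assumptions. For some $\alpha\in(0,1)$: $A\in C^{1,\alpha}_{loc}\cap L^\infty(\overline\Omega)$, $B,c\in C^{0,\alpha}_{loc}\cap L^\infty(\overline\Omega)$, $\gamma\in C^{1,\alpha}_{loc}\cap L^\infty(\partial\Omega)$; the domain $\Omega$ is of class $C^n_{loc}$, or $C^{2,\alpha}_{loc}$ if $n=2$; $A$ is symmetric positive definite. Uniform regularity. ''Uniformly $C^{k,\alpha}$'' means that the $C^{k,\alpha}$ norm over the whole domain of definition is finite. $\Omega$ is uniformly $C^2$ if there exist $R,C>0$ such that for every $x_0\in\partial\Omega$ there is a function $g:\mathbb{R}^{n-1}\to\mathbb{R}$ with $\|g\|_{C^2}\le C$ and, in some (orthonormal) system of coordinates $(x',x_n)$ centered at $x_0$, $\Omega\cap\{|x|\le R\}=\{(x',x_n):x_n>g(x')\}\cap\{|x|\le R\}$. Definitions. A function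 $u\in C^{2,\alpha}_{loc}(\overline\Omega)$ is a subsolution (resp. supersolution) of $(\mathcal{L},\mathcal{B})$ in $\Omega$ if $\mathcal{L}u\le0$ (resp. $\ge0$) in $\Omega$ and $\mathcal{B}u\le0$ (resp. $\ge0$) on $\partial\Omega$. $(\mathcal{L},\mathcal{B})$ satisfies the Maximum Principle in $\Omega$ if every subsolution with finite supremum is nonpositive. *)

(* Defs.v *)
From HB Require Import structures.
From mathcomp Require Import all_boot all_order all_algebra.
From mathcomp Require Import all_classical all_reals all_analysis.

Set Implicit Arguments.
Unset Strict Implicit.
Unset Printing Implicit Defensive.

Import Order.TTheory GRing.Theory Num.Theory.
Import numFieldNormedType.Exports.

Local Open Scope classical_set_scope.
Local Open Scope ring_scope.

(* Points and vectors of R^n are row vectors. The library norm on 'rV[R]_n is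
   the sup norm, so the Euclidean structure is defined here; the two norms
   induce the same topology. *)

Section Spaces.
Context {R : realType} {n : nat}.
Implicit Types (u v x y : 'rV[R]_n) (D S : set 'rV[R]_n) (f : 'rV[R]_n -> R).

Definition dotv u v : R := \sum_i u 0 i * v 0 i.

Definition enorm v : R := Num.sqrt (dotv v v).

(* The topological boundary, for D open. *)
Definition boundary D : set 'rV[R]_n := closure D `\` D.

Definition is_domain D : Prop := [/\ D !=set0, open D & connected D].

(* Continuous extension to the closure of D of a function defined in D. *)
Definition ext D f x : R :=
  if x \in D then f x else lim (f y @[y --> within D (nbhs x)]).

(* In the open set D this is the i-th partial derivative, on the boundary of D
   its continuous extension. *)
Definition pd D (i : 'I_n) f : 'rV[R]_n -> R :=
  ext D (fun x => 'D_(delta_mx 0 i) f x).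

(* A multi-index is given as the list of the variables of differentiation. *)
Definition pds D (s : seq 'I_n) f : 'rV[R]_n -> R := foldr (pd D) f s.

Definition grad D f x : 'rV[R]_n := \row_i pd D i f x.

(* f is of class C^k up to the boundary of the open set D: the partial
   derivatives of order at most k exist in D and extend continuously to the
   closure of D (f being itself given on the closure). *)
Definition Ck (k : nat) D f : Prop :=
  forall s : seq 'I_n, (size s <= k)%N ->
    {within closure D, continuous (pds D s f)} /\
    ((size s < k)%N ->
       forall (i : 'I_n) x, D x -> derivable (pds D s f) x (delta_mx 0 i)).

(* The C^k norm over S is the largest supremum over S of a partial derivative
   of order at most k; the C^(k,a) norm also involves the a-Hoelder seminorms
   over S of the partial derivatives of order k. *)
Definition Ck_norm_le (k : nat) D S (M : R) f : Prop :=
  forall s : seq 'I_n, (size s <= k)%N ->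
    forall x, S x -> `|pds D s f x| <= M.

Definition Cka_norm_le (k : nat) (a : R) D S (M : R) f : Prop :=
  Ck_norm_le k D S M f /\
  forall s : seq 'I_n, size s = k ->
    forall x y, S x -> S y ->
      `|pds D s f x - pds D s f y| <= M * enorm (x - y) `^ a.

Definition Cka_loc (k : nat) (a : R) D f : Prop :=
  Ck k D f /\
  forall K : set 'rV[R]_n, compact K -> K `<=` closure D ->
    exists M : R, Cka_norm_le k a D K M f.

Definition Cka_unif (k : nat) (a : R) D f : Prop :=
  Ck k D f /\ exists M : R, Cka_norm_le k a D (closure D) M f.

Definition bounded_on S f : Prop := exists M : R, forall x, S x -> `|f x| <= M.

Definition holder_on (a : R) S f : Prop :=
  exists M : R, (forall x, S x -> `|f x| <= M) /\
    forall x y, S x -> S y -> `|f x - f y| <= M * enorm (x - y) `^ a.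

End Spaces.

(* The ambient space is R^(n+1), that is R^N with N = n.+1 >= 1, so that graphs
   are those of functions on R^(N-1) = 'rV[R]_n. *)

Section Boundary.
Context {R : realType} {n : nat}.
Implicit Types (O : set 'rV[R]_n.+1) (Q : 'M[R]_n.+1).
Implicit Types (g : 'rV[R]_n -> R) (gamma : 'rV[R]_n.+1 -> R).

(* The point with coordinates (x', t), t being the last one; conversely, the
   coordinates of y are (col' ord_max y, y 0 ord_max). *)
Definition join_last (x' : 'rV[R]_n) (t : R) : 'rV[R]_n.+1 :=
  \row_i (if unlift ord_max i is Some j then x' 0 j else t).

(* The rows of Q are the axes of an orthonormal system of coordinates centered
   at x0: y is the coordinate vector of the point x0 + y *m Q. In the closed
   ball of radius r, O is the region above the graph of g. *)
Definition graph_chart O (x0 : 'rV[R]_n.+1) (r : R) Q g : Prop :=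
  [/\ 0 < r, Q *m Q^T = 1%:M &
      forall y : 'rV[R]_n.+1, enorm y <= r ->
        (O (x0 + y *m Q) <-> g (col' ord_max y) < y 0 ord_max)].

(* Of class C^N, resp. C^(2,a) when N = 2. *)
Definition loc_regular_domain (a : R) O : Prop :=
  forall x0, boundary O x0 ->
    exists (r : R) Q g, graph_chart O x0 r Q g /\
      (if n.+1 == 2%N then Cka_loc 2 a setT g else Ck n.+1 setT g).

Definition uniformly_C2_domain O : Prop :=
  exists r C : R, [/\ 0 < r, 0 < C &
    forall x0, boundary O x0 ->
      exists Q g, [/\ graph_chart O x0 r Q g, Ck 2 setT g &
                      Ck_norm_le 2 setT setT C g]].

(* Regularity of a function on the boundary is that of its expression in local
   coordinates x' |-> (x', g x'). *)
Definition C1a_loc_boundary (a : R) O gamma : Prop :=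
  forall x0, boundary O x0 ->
    exists (r : R) Q g (rho : R),
      [/\ graph_chart O x0 r Q g, Cka_loc 1 a setT g, 0 < rho &
          Cka_loc 1 a [set x' | enorm x' < rho]
            (fun x' => gamma (x0 + join_last x' (g x') *m Q))].

(* O lies above the graph of g, so the outer normal points along
   (grad g, -1) in the local coordinates. *)
Definition is_outer_normal O (x0 nu : 'rV[R]_n.+1) : Prop :=
  exists (r : R) Q g, [/\ graph_chart O x0 r Q g, Ck 1 setT g &
    let w := join_last (grad setT g 0) (-1) in
    nu = ((enorm w)^-1 *: w) *m Q].

Definition outer_normal O (x0 : 'rV[R]_n.+1) : 'rV[R]_n.+1 :=
  xget 0 [set nu | is_outer_normal O x0 nu].

End Boundary.

Section Operators.
Context {R : realType} {n : nat}.
Local Notation vec := 'rV[R]_n.+1.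
Implicit Types (O : set vec) (u c gamma : vec -> R).
Implicit Types (A : vec -> 'M[R]_n.+1) (B : vec -> vec).

(* The vector field A grad u, written as a row. *)
Definition flux O A u (x : vec) : vec := (A x *m (grad O u x)^T)^T.

Definition elliptic_op O A B c u (x : vec) : R :=
  - (\sum_i pd O i (fun y => flux O A u y 0 i) x)
  - dotv (B x) (grad O u x) - c x * u x.

Inductive boundary_condition : Type :=
  | Dirichlet
  | Robin of (vec -> R).

Definition boundary_op O A (bc : boundary_condition) u (x : vec) : R :=
  match bc with
  | Dirichlet => u x
  | Robin gamma => dotv (outer_normal O x) (flux O A u x) + gamma x * u x
  end.

Definition shift_op (L : (vec -> R) -> vec -> R) (lambda : R) u (x : vec) : R :=
  L u x - lambda * u x.

Definition subsolution (a : R) O (L Bd : (vec -> R) -> vec -> R) u : Prop :=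
  [/\ Cka_loc 2 a O u, (forall x, O x -> L u x <= 0) &
      (forall x, boundary O x -> Bd u x <= 0)].

Definition supersolution (a : R) O (L Bd : (vec -> R) -> vec -> R) u : Prop :=
  [/\ Cka_loc 2 a O u, (forall x, O x -> 0 <= L u x) &
      (forall x, boundary O x -> 0 <= Bd u x)].

Definition maximum_principle (a : R) O (L Bd : (vec -> R) -> vec -> R) : Prop :=
  forall u, subsolution a O L Bd u ->
    (ereal_sup [set (u x)%:E | x in O] < +oo)%E ->
    forall x, O x -> u x <= 0.

(* Extended-real supremum: no convention is made for an empty or unbounded set. *)
Definition tilde_lambda1 (a : R) O (L Bd : (vec -> R) -> vec -> R) : \bar R :=
  ereal_sup [set lambda%:E | lambda in
    [set lambda : R | exists u, supersolution a O (shift_op L lambda) Bd u /\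
       (0 < ereal_inf [set (u x)%:E | x in O])%E]].

Definition symmetric_posdef O A : Prop :=
  forall x, O x -> (A x)^T = A x /\
    forall v : vec, v != 0 -> 0 < dotv v (v *m A x).

Definition uniformly_elliptic O A : Prop :=
  exists2 a0 : R, 0 < a0 &
    forall x, O x -> forall v : vec, a0 * dotv v v <= dotv v (v *m A x).

Definition standing_coefficients (a : R) O A B c : Prop :=
  [/\ forall i j, Cka_loc 1 a O (fun x => A x i j) /\
                  bounded_on (closure O) (fun x => A x i j),
      forall i, Cka_loc 0 a O (fun x => B x 0 i) /\
                bounded_on (closure O) (fun x => B x 0 i),
      Cka_loc 0 a O c /\ bounded_on (closure O) c &
      symmetric_posdef O A].

Definition standing_boundary (a : R) O (bc : boundary_condition) : Prop :=
  match bc with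
  | Dirichlet => True
  | Robin gamma => C1a_loc_boundary a O gamma /\ bounded_on (boundary O) gamma
  end.

Definition uniform_coefficients (a : R) O A B c : Prop :=
  [/\ forall i j, Cka_unif 1 a O (fun x => A x i j),
      forall i, Cka_unif 0 a O (fun x => B x 0 i),
      Cka_unif 0 a O c &
      uniformly_elliptic O A].

Definition uniform_boundary (a : R) O (bc : boundary_condition) : Prop :=
  match bc with
  | Dirichlet => True
  | Robin gamma => holder_on a (boundary O) gamma
  end.

End Operators.

Arguments boundary_condition R n : clear implicits.
Arguments Dirichlet {R n}.

(* Main.v *)
Require Import Defs.
From mathcomp Require Import all_boot all_order all_algebra.
From mathcomp Require Import all_classical all_reals all_analysis.
From mathcomp Require Import ring lra.
Set Implicit Arguments.
Unset Strict Implicit.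
Unset Printing Implicit Defensive.
Import Order.TTheory GRing.Theory Num.Theory.
Import numFieldNormedType.Exports.
Local Open Scope classical_set_scope.
Local Open Scope ring_scope.

(* Let lam > 0 and a supersolution v of (L - lam, B) with v >= m > 0 be given, and
   let k be the supremum of u / v for a subsolution u that is positive somewhere.
   Then w = k v - u is nonnegative with L w >= k lam m > 0 and B w >= 0, and k
   could be lowered if w were bounded away from 0, v being bounded where u / v is
   close to k.  So it is enough to bound w from below.

   To do this, minimise w + e psi over a small ball near a point z where w
   is small, with psi a quadratic polynomial and e > 0 small.  When psi is larger
   on the sphere than at z, the minimum is not on the sphere; neither is it in the
   interior, where the first and second order conditions give L w = O(e) at the
   minimum point.  For Dirichlet conditions it is not on the boundary either, w
   being at least k m there.  For Robin conditions the derivative of w + e psi along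
   nu A is nonpositive at a boundary minimum; psi contains a large multiple of a
   linear function that increases in the outward direction, and the smallness of w
   at the minimum makes this contradict B w >= 0 whatever the sign of gamma. *)

(** * Euclidean norm and epsilon-delta forms *)

Section Euclid.
Context {R : realType} {n : nat}.
Implicit Types (u v x y : 'rV[R]_n) (D : set 'rV[R]_n).

Lemma dotvC u v : dotv u v = dotv v u.
Proof. by apply: eq_bigr => i _; rewrite mulrC. Qed.

Lemma dotvE u v : dotv u v = (u *m v^T) 0 0.
Proof. by rewrite mxE; apply: eq_bigr => i _; rewrite mxE. Qed.

Lemma dotvDl u v x : dotv (u + v) x = dotv u x + dotv v x.
Proof. by rewrite -big_split; apply: eq_bigr => i _; rewrite mxE mulrDl. Qed.

Lemma dotvZl a u v : dotv (a *: u) v = a * dotv u v.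
Proof. by rewrite mulr_sumr; apply: eq_bigr => i _; rewrite mxE mulrA. Qed.

Lemma dotvDr u v x : dotv x (u + v) = dotv x u + dotv x v.
Proof. by rewrite !(dotvC x) dotvDl. Qed.

Lemma dotvZr a u v : dotv u (a *: v) = a * dotv u v.
Proof. by rewrite !(dotvC u) dotvZl. Qed.

Lemma dotvNl u v : dotv (- u) v = - dotv u v.
Proof. by rewrite -scaleN1r dotvZl mulN1r. Qed.

Lemma dotvNr u v : dotv u (- v) = - dotv u v.
Proof. by rewrite !(dotvC u) dotvNl. Qed.

Lemma dotv_ge0 u : 0 <= dotv u u.
Proof. by apply: sumr_ge0 => i _; rewrite -expr2 sqr_ge0. Qed.

Lemma enorm_ge0 u : 0 <= enorm u.
Proof. exact: sqrtr_ge0. Qed.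

Lemma sqr_enorm u : enorm u ^+ 2 = dotv u u.
Proof. by rewrite sqr_sqrtr // dotv_ge0. Qed.

Lemma enormZ a u : enorm (a *: u) = `|a| * enorm u.
Proof.
by rewrite /enorm dotvZl dotvZr mulrA -expr2 sqrtrM ?sqr_ge0 // sqrtr_sqr.
Qed.

Lemma enormN u : enorm (- u) = enorm u.
Proof. by rewrite -scaleN1r enormZ normrN1 mul1r. Qed.

Lemma enorm0 : enorm (0 : 'rV[R]_n) = 0.
Proof. by rewrite -(scale0r 0) enormZ normr0 mul0r. Qed.

Lemma coord_le_enorm u i : `|u 0 i| <= enorm u.
Proof.
rewrite -sqrtr_sqr; apply: ler_wsqrtr.
rewrite /dotv (bigD1 i) //= -expr2 lerDl.
by apply: sumr_ge0 => j _; rewrite -expr2 sqr_ge0.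
Qed.

(** The square of [dotv v v *: u - dotv u v *: v] is nonnegative and factors as [dotv v v] times the
    difference of the squared sides; the case [v = 0] is separate because that factor then
    vanishes. *)
Lemma cauchy_schwarz u v : `|dotv u v| <= enorm u * enorm v.
Proof.
have [v0|v_neq0] := eqVneq (enorm v) 0.
  have vi i : v 0 i = 0.
    by apply/eqP; rewrite -normr_le0 -v0 coord_le_enorm.
  have -> : dotv u v = 0 by rewrite /dotv big1 // => i _; rewrite vi mulr0.
  by rewrite normr0 v0 mulr0.
have v_gt0 : 0 < dotv v v by rewrite -sqr_enorm exprn_even_gt0.
rewrite -ler_sqr ?nnegrE ?mulr_ge0 ?enorm_ge0 // real_normK ?num_real //.
rewrite exprMn !sqr_enorm.
have := dotv_ge0 (dotv v v *: u - dotv u v *: v).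
rewrite dotvDl !dotvDr !(dotvNl, dotvNr) !(dotvZl, dotvZr) (dotvC v u).
move: (dotv u u) (dotv u v) (dotv v v) v_gt0 => a b c c_gt0 h.
have : 0 <= c * (a * c - b ^+ 2) by apply: le_trans h _; lra.
by rewrite pmulr_rge0 // subr_ge0.
Qed.

Lemma enormD u v : enorm (u + v) <= enorm u + enorm v.
Proof.
rewrite -ler_sqr ?nnegrE ?addr_ge0 ?enorm_ge0 // sqr_enorm.
rewrite dotvDl !dotvDr (dotvC v u) sqrrD !sqr_enorm.
have := le_trans (ler_norm _) (cauchy_schwarz u v); lra.
Qed.

Lemma norm_le_enorm v : `|v| <= enorm v.
Proof.
rewrite [leLHS]mx_normrE; apply/bigmax_leP; split=> [|[i j] _].
  exact: enorm_ge0.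
by rewrite [i]ord1 coord_le_enorm.
Qed.

Lemma enorm_le_norm v : enorm v <= n%:R * `|v|.
Proof.
case: n v => [|m] v.
  by rewrite /enorm /dotv big_ord0 sqrtr0 mul0r.
rewrite -(@ger0_norm _ (m.+1%:R * _)) ?mulr_ge0 ?ler0n // -sqrtr_sqr.
apply: ler_wsqrtr; rewrite exprMn.
apply: (@le_trans _ _ (\sum_(i < m.+1) `|v| ^+ 2)).
  apply: ler_sum => i _; rewrite -expr2 -(real_normK (num_real (v 0 i))).
  rewrite ler_sqr ?nnegrE //.
  have /mapP[j Hj ->] : `|v 0 i| \in [seq `|v x.1 x.2| | x : 'I_1 * 'I_m.+1].
    by apply/mapP; exists (0, i) => //=; rewrite mem_enum.
  by rewrite [leRHS]mx_normrE; apply/bigmax_geP; right => /=; exists j.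
rewrite sumr_const card_ord -[leLHS]mulr_natl; apply: ler_wpM2r => //.
by rewrite -natrX ler_nat -[leqLHS]muln1 leq_mul2l orbT.
Qed.

Lemma nbhs_enorm x (P : set 'rV[R]_n) :
  nbhs x P <-> exists2 d, 0 < d & forall y, enorm (y - x) < d -> P y.
Proof.
split=> [/nbhs_ballP[d /= d_gt0 dP]|[d d_gt0 dP]].
  exists d => // y yd; apply: dP; rewrite -ball_normE /= distrC.
  exact: le_lt_trans (norm_le_enorm _) yd.
(* [n.+1] rather than [n] keeps the radius positive in dimension zero. *)
apply/nbhs_ballP; exists (d / n.+1%:R) => /=; first by rewrite divr_gt0.
move=> y; rewrite -ball_normE /= distrC => yd; apply: dP.
apply: le_lt_trans (enorm_le_norm _) _.
move: yd; rewrite ltr_pdivlMr // -natr1 => yd.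
have := normr_ge0 (y - x); have : 0 <= n%:R :> R by []; nra.
Qed.

Lemma closure_enorm (S : set 'rV[R]_n) x r : closure S x -> 0 < r ->
  exists2 y, S y & enorm (y - x) < r.
Proof.
move=> clS r_gt0; have h : nbhs x [set y | enorm (y - x) < r].
  by apply/nbhs_enorm; exists r.
by have [y [Sy yr]] := clS _ h; exists y.
Qed.

Lemma open_enorm {D} x : open D -> D x ->
  exists2 d, 0 < d & forall y, enorm (y - x) < d -> D y.
Proof. by move=> oD Dx; apply/nbhs_enorm; exact: open_nbhs_nbhs. Qed.

Lemma within_continuous_enorm (S : set 'rV[R]_n) (f : 'rV[R]_n -> R) :
  {within S, continuous f} <->
  forall x, S x -> forall e, 0 < e -> exists2 d, 0 < d &
    forall y, S y -> enorm (y - x) < d -> `|f y - f x| < e.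
Proof.
rewrite subspace_continuousP; split=> [fc x Sx e e_gt0|h x Sx].
  have /nbhs_enorm[d d_gt0 dP] := fc x Sx _ (nbhsx_ballx (f x) e e_gt0).
  by exists d => // y Sy yd; rewrite distrC; exact: dP.
apply/cvgrPdist_lt => e e_gt0; have [d d_gt0 dP] := h x Sx e e_gt0.
by apply/nbhs_enorm; exists d => // y yd Sy; rewrite distrC; exact: dP.
Qed.

End Euclid.

(** * Derivatives along lines *)

Section LineDerivatives.
Context {R : realType}.

Lemma is_derive_line {n} (f : 'rV[R]_n -> R) a v (t d : R) :
  is_derive (a + t *: v) v f d -> is_derive t 1 (fun s => f (a + s *: v)) d.
Proof.
have E : (fun h : R => h^-1 *: ((f \o shift (a + t *: v)) (h *: v)
                                - f (a + t *: v))) =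
         (fun h => h^-1 *: (((fun s => f (a + s *: v)) \o shift t) (h *: 1)
                                - f (a + t *: v))).
  apply/funext => h /=; congr (_ *: (f _ - _)).
  by rewrite [h *: 1]mulr1 scalerDl addrCA.
by case=> df <-; split; rewrite /derivable /derive -E.
Qed.

(** The error is compared with [e * |h|] instead of being divided by [h], so that later estimates
    need not exclude [h = 0]. *)
Lemma is_derive_eps (f : R -> R) (x d : R) :
  (forall e, 0 < e -> exists2 r, 0 < r &
     forall h, `|h| < r -> `|f (x + h) - f x - h * d| <= e * `|h|) ->
  is_derive x 1 f d.
Proof.
move=> H.
have cv : h^-1 *: ((f \o shift x) (h *: 1) - f x) @[h --> 0^'] --> d.
  apply/cvgrPdist_le => e e_gt0; have [r r_gt0 rP] := H e e_gt0.
  near=> h.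
  have h0 : h != 0 by near: h; exact: nbhs_dnbhs_neq.
  have hr : `|h| < r.
    near: h; apply: cvg_within; apply/nbhs_ballP; exists r => //= y.
    by rewrite -ball_normE /= sub0r normrN.
  have le := rP h hr; rewrite distrC /= [h *: 1]mulr1 (addrC h).
  have -> : h^-1 *: (f (x + h) - f x) - d = h^-1 * (f (x + h) - f x - h * d).
    by rewrite mulrBr mulKf.
  by rewrite normrM normfV mulrC ler_pdivrMr ?normr_gt0.
by split; [apply/cvg_ex; exists d|exact: cvg_lim].
Unshelve. all: by end_near. Qed.

Lemma is_derive_epsP (f : R -> R) (x d : R) : is_derive x 1 f d ->
  forall e, 0 < e -> exists2 r, 0 < r &
     forall h, `|h| < r -> `|f (x + h) - f x - h * d| <= e * `|h|.
Proof.
case=> df fd e e_gt0.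
have /cvgrPdist_le/(_ e e_gt0) : h^-1 *: ((f \o shift x) (h *: 1) - f x) @[h --> 0^'] --> d.
  by rewrite -fd; exact: df.
move=> /nbhs_ballP[r /= r_gt0 rP]; exists r => // h hr.
have [->|h0] := eqVneq h 0; first by rewrite addr0 subrr mul0r subr0 normr0 mulr0.
have := rP h; rewrite -ball_normE /= sub0r normrN => /(_ hr h0).
rewrite [h *: 1]mulr1 (addrC h) distrC => le.
have -> : f (x + h) - f x - h * d = h * (h^-1 *: (f (x + h) - f x) - d).
  by rewrite mulrBr mulVKf.
by rewrite normrM mulrC ler_wpM2r.
Qed.

Lemma is_derive_within (f df : R -> R) (S : set R) :
  (forall x, S x -> is_derive x 1 f (df x)) -> {within S, continuous f}.
Proof.
move=> H; apply: continuous_in_subspaceT => x; rewrite inE => Sx.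
have dfx := H x Sx; apply: differentiable_continuous.
by apply/derivable1_diffP; case: dfx.
Qed.

Lemma mean_value (f df : R -> R) (a b : R) : a < b ->
    (forall t, a < t < b -> is_derive t 1 f (df t)) ->
    {within `[a, b], continuous f} ->
  exists2 t, a < t < b & f b - f a = df t * (b - a).
Proof.
move=> ab dfP fc; have dfP' t : t \in `]a, b[ -> is_derive t 1 f (df t).
  by rewrite in_itv; exact: dfP.
by have [t] := MVT ab dfP' fc; rewrite in_itv; exists t.
Qed.

Lemma MVT_line {n} (f : 'rV[R]_n -> R) (df : R -> R) (a v : 'rV[R]_n) :
  (forall t : R, 0 <= t <= 1 -> is_derive t 1 (fun s => f (a + s *: v)) (df t)) ->
  exists2 t : R, 0 <= t <= 1 & f (a + v) - f a = df t.
Proof.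
move=> H; pose h s := f (a + s *: v).
have hc : {within `[0, 1], continuous h}.
  by apply: (@is_derive_within h df) => t /=; rewrite in_itv; exact: H.
have hD (t : R) : 0 < t < 1 -> is_derive t 1 h (df t).
  by move=> /andP[t0 t1]; apply: H; rewrite !ltW.
have [t t01] := mean_value ltr01 hD hc.
rewrite /h scale1r scale0r addr0 subr0 mulr1 => E; exists t => //.
by case/andP: t01 => /ltW -> /ltW ->.
Qed.

(** The partial derivatives are carried as a family [G]; a combination [k v - u] can then be handled
    with the combined family, without computing its [pd]. *)
Definition C1_data {n} (D : set 'rV[R]_n) (f : 'rV[R]_n -> R)
    (G : 'I_n -> 'rV[R]_n -> R) :=
  (forall i x, D x -> is_derive x (delta_mx 0 i) f (G i x)) /\
  (forall i, {within D, continuous (G i)}).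

(** Continuous partial derivatives give differentiability: [x] is joined to [x + v] by changing one
    coordinate at a time, and the mean value theorem is applied on each of the [n] segments with
    error [e']. *)
Lemma C1_increment {n} (D : set 'rV[R]_n) f G x : open D -> C1_data D f G -> D x ->
  forall e, 0 < e -> exists2 d, 0 < d & forall v, enorm v < d ->
    `|f (x + v) - f x - \sum_i v 0 i * G i x| <= e * enorm v.
Proof.
move=> oD [fG Gc] Dx e e_gt0.
pose e' := e / n.+1%:R; have e'_gt0 : 0 < e' by rewrite divr_gt0.
have /choice[dG dGP] : forall i, exists d, 0 < d /\
    forall y, D y -> enorm (y - x) < d -> `|G i y - G i x| < e'.
  move=> i; have /within_continuous_enorm/(_ x Dx e' e'_gt0)[d] := Gc i.
  by exists d.
have [d0 d0_gt0 d0P] := open_enorm oD Dx.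
pose d := \big[Num.min/d0]_i dG i.
have d_gt0 : 0 < d.
  by rewrite /d; elim/big_ind: _ => // [a b ha hb|i _];
    [rewrite lt_min ha hb|exact: (dGP i).1].
have dd0 : d <= d0 by exact: bigmin_le_id.
have ddG i : d <= dG i by exact: bigmin_le_cond.
exists d => // v vd.
(* The vertices of the path. Every point of it is no longer than [v], so the path stays in the ball
   where the partial derivatives vary by less than [e']. *)
pose c k : 'rV[R]_n := \row_i (if (i < k)%N then v 0 i else 0).
have step k : (k <= n)%N -> `|f (x + c k) - f x -
    \sum_(i < n | (i < k)%N) v 0 i * G i x| <= (e' * k%:R) * enorm v.
  elim: k => [|k IHk] kn.
    have -> : c 0%N = 0 by apply/rowP => i; rewrite !mxE.
    by rewrite big_pred0 // addr0 subrr subr0 normr0 mulr0 mul0r.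
  have := IHk (ltnW kn).
  pose i0 := Ordinal kn.
  have cE : c k.+1 = c k + v 0 i0 *: delta_mx 0 i0.
    apply/rowP => i; rewrite !mxE eqxx /= ltnS leq_eqVlt.
    have [->|ii0] := eqVneq i i0; first by rewrite /= eqxx ltnn mulr1 add0r.
    have -> : (i == k :> nat) = false by apply: contra_neqF ii0 => /eqP ik; exact: val_inj.
    by rewrite mulr0 addr0.
  have small t : 0 <= t <= 1 -> enorm (c k + (t * v 0 i0) *: delta_mx 0 i0) <= enorm v.
    move=> /andP[t0 t1]; apply: ler_wsqrtr; apply: ler_sum => i _.
    rewrite !mxE eqxx /= -!expr2.
    have [->|ii0] := eqVneq i i0.
      rewrite /= ltnn add0r mulr1 exprMn -[leRHS]mul1r.
      by rewrite ler_wpM2r ?sqr_ge0 // exprn_ile1.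
    rewrite mulr0 addr0; case: ifP => // _.
    by rewrite expr0n sqr_ge0.
  have inD t : 0 <= t <= 1 ->
      enorm (x + c k + t *: (v 0 i0 *: delta_mx 0 i0) - x) < d.
    move=> t01; rewrite -(addrA x) addrAC subrr add0r scalerA.
    exact: le_lt_trans (small t t01) vd.
  have [t t01 E] : exists2 t, 0 <= t <= 1 &
      f (x + c k + v 0 i0 *: delta_mx 0 i0) - f (x + c k) =
      v 0 i0 * G i0 (x + c k + t *: (v 0 i0 *: delta_mx 0 i0)).
    apply: (@MVT_line _ f
      (fun t => v 0 i0 * G i0 (x + c k + t *: (v 0 i0 *: delta_mx 0 i0)))) => t t01.
    have Dt : D (x + c k + t *: (v 0 i0 *: delta_mx 0 i0)).
      by apply: d0P; exact: lt_le_trans (inD t t01) dd0.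
    rewrite scalerA in Dt *; have := is_derive_line (fG i0 _ Dt).
    have -> : (fun s => f (x + c k + s *: (v 0 i0 *: delta_mx 0 i0))) =
        (fun s => f (x + c k + s *: delta_mx 0 i0)) \o (fun s => s * v 0 i0).
      by apply/funext => s /=; rewrite scalerA.
    move=> dG'; rewrite mulrC; apply: is_derive1_comp.
    have -> : (fun s : R => s * v 0 i0) = v 0 i0 *: id.
      by apply/funext => s; rewrite mulrC.
    apply: is_derive_eq; exact: mulr1.
  have Dt : D (x + c k + t *: (v 0 i0 *: delta_mx 0 i0)).
    by apply: d0P; exact: lt_le_trans (inD t t01) dd0.
  have Gt := (dGP i0).2 _ Dt (lt_le_trans (inD t t01) (ddG i0)).
  rewrite cE addrA => IH.
  have -> : \sum_(i < n | (i < k.+1)%N) v 0 i * G i x =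
      v 0 i0 * G i0 x + \sum_(i < n | (i < k)%N) v 0 i * G i x.
    rewrite (bigD1 i0) /=; last exact: ltnSn.
    congr (_ + _); apply: eq_bigl => i; rewrite ltnS leq_eqVlt.
    have [->|ii0] := eqVneq i i0; first by rewrite /= ltnn andbF.
    by rewrite andbT; case: eqP => // ik; move: ii0; rewrite -val_eqE /= ik eqxx.
  set S := (\sum_(i < n | _) _) in IH *.
  have H : `|v 0 i0 * (G i0 (x + c k + t *: (v 0 i0 *: delta_mx 0 i0)) - G i0 x)|
      <= e' * enorm v.
    by rewrite normrM mulrC ler_pM // ?coord_le_enorm // ltW.
  set T := G i0 (_ + _) in E H.
  have -> : f (x + c k + v 0 i0 *: delta_mx 0 i0) - f x - (v 0 i0 * G i0 x + S)
     = (f (x + c k) - f x - S) + v 0 i0 * (T - G i0 x).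
    by move: E => /eqP; rewrite subr_eq => /eqP ->; ring.
  have -> : e' * k.+1%:R = e' * k%:R + e' by rewrite -addn1 natrD mulrDr mulr1.
  by apply: le_trans (ler_normD _ _) _; rewrite mulrDl; exact: lerD.
have := step n (leqnn n).
have -> : c n = v by apply/rowP => i; rewrite mxE ltn_ord.
rewrite (eq_bigl predT) => [le|i]; last by rewrite ltn_ord.
apply: le_trans le _; apply: ler_wpM2r; first exact: enorm_ge0.
by rewrite /e' mulrAC ler_pdivrMr // ler_wpM2l ?ler_nat // ltW.
Qed.

Lemma C1_line {n} (D : set 'rV[R]_n) f G x v (t : R) : open D -> C1_data D f G ->
  D (x + t *: v) ->
  is_derive t 1 (fun s => f (x + s *: v)) (\sum_i v 0 i * G i (x + t *: v)).
Proof.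
move=> oD fG Dx; apply: is_derive_eps => e e_gt0.
have V0 : 0 < 1 + enorm v by rewrite ltr_pwDl ?enorm_ge0.
have [d d_gt0 dP] := C1_increment oD fG Dx (divr_gt0 e_gt0 V0).
exists (d / (1 + enorm v)); first exact: divr_gt0.
move=> h; rewrite ltr_pdivlMr // => hd.
have vd : enorm (h *: v) < d.
  rewrite enormZ; apply: le_lt_trans hd; apply: ler_wpM2l => //.
  by rewrite lerDr.
have := dP _ vd; rewrite -(addrA x) -scalerDl mulr_sumr.
rewrite (eq_bigr (fun i => h * (v 0 i * G i (x + t *: v)))); last first.
  by move=> i _; rewrite mxE mulrA.
move=> le; apply: le_trans le _; rewrite enormZ.
have -> : e / (1 + enorm v) * (`|h| * enorm v) =
    e * `|h| * (enorm v / (1 + enorm v)) by ring.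
apply: ler_piMr; first by rewrite mulr_ge0 // ltW.
by rewrite ler_pdivrMr // mul1r lerDr.
Qed.

Lemma is_derive_quadratic (a b x : R) :
  is_derive x 1 (fun t => a * t + b * t ^+ 2) (a + 2 * b * x).
Proof.
apply: is_derive_eps => e e_gt0; have B0 : 0 < 1 + `|b| by rewrite ltr_pwDl.
exists (e / (1 + `|b|)); first exact: divr_gt0.
move=> h; rewrite ltr_pdivlMr // => he.
have -> : a * (x + h) + b * (x + h) ^+ 2 - (a * x + b * x ^+ 2)
  - h * (a + 2 * b * x) = b * h * h by ring.
rewrite 2!normrM ler_wpM2r //; apply: le_trans (ltW he).
by rewrite mulrC ler_wpM2l // lerDr.
Qed.

(** The function [h t + a t + b t^2] has a local minimum at 0. If its second derivative [m + 2 b]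
    were negative, its derivative would be negative just to the right of 0, and the mean value
    theorem would produce a smaller value. *)
Lemma second_order_min (h dh : R -> R) (m a b r : R) : 0 < r ->
    (forall t : R, `|t| < r -> is_derive t 1 h (dh t)) -> is_derive (0 : R) 1 dh m ->
    (forall t, `|t| < r -> h 0 <= h t + a * t + b * t ^+ 2) ->
  dh 0 = - a /\ - (2 * b) <= m.
Proof.
move=> r_gt0 dhP ddh hmin.
pose q (t : R) := a * t + b * t ^+ 2.
pose k t := h t + q t; pose dk t := dh t + (a + 2 * b * t).
have kP (t : R) : `|t| < r -> is_derive t 1 k (dk t).
  by move=> /dhP dht; exact: is_deriveD dht (is_derive_quadratic a b t).
have dkP : is_derive (0 : R) 1 dk (m + 2 * b).
  have := is_derive_quadratic (2 * b) 0 0; rewrite mulr0 addr0 => q'.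
  have -> : dk = (dh + cst a) + (fun t => 2 * b * t + 0 * t ^+ 2).
    by apply/funext => t; rewrite /dk /= !fctE mul0r addr0 addrA.
  by have := is_deriveD (is_deriveD ddh (is_derive_cst a (0 : R) (1 : R))) q'; rewrite addr0.
have k0 t : `|t| < r -> k 0 <= k t.
  by move=> /hmin; rewrite /k /q mulr0 expr0n mulr0 !addr0 addrA.
have r0 : `|0 : R| < r by rewrite normr0.
have k'0 : is_derive (0 : R) 1 k 0.
  apply: (@derive1_at_min _ k (- r) r 0) => [|t||t]; rewrite ?in_itv /=; try lra.
    by rewrite -ltr_norml => /kP[].
  by rewrite -ltr_norml => /k0.
have dk0 : dk 0 = 0 by have [_ <-] := kP 0 r0; have [_ ->] := k'0.
split; first by move: dk0; rewrite /dk; lra.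
rewrite leNgt; apply/negP => lt.
(* With this error the derivative at a small [s > 0] is at most [s (m + 2 b) / 2], still
   negative. *)
have e_gt0 : 0 < - (m + 2 * b) / 2 by lra.
have [d d_gt0 dP] := is_derive_epsP dkP e_gt0.
pose t := Num.min d r / 2.
have t0 : 0 < t by rewrite divr_gt0 // lt_min d_gt0.
have td : t < d by have : Num.min d r <= d by [rewrite ge_min lexx]; rewrite /t; lra.
have tr : t < r by have : Num.min d r <= r by [rewrite ge_min lexx orbT]; rewrite /t; lra.
have kc : {within `[0, t], continuous k}.
  apply: (@is_derive_within k dk) => s /=; rewrite in_itv /= => /andP[s0 st].
  by apply: kP; rewrite ger0_norm // (le_lt_trans st).
have [s /andP[s0 st] E] : exists2 s, 0 < s < t & k t - k 0 = dk s * (t - 0).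
  apply: mean_value t0 _ kc => s /andP[s0 st].
  by apply: kP; rewrite gtr0_norm // (lt_trans st).
have := dP s; rewrite add0r dk0 subr0 gtr0_norm // => /(_ (lt_trans st td)).
rewrite ler_norml => /andP[_ le].
have : dk s < 0 by nra.
have := k0 t; rewrite gtr0_norm // => /(_ tr); nra.
Qed.

End LineDerivatives.

(** * Pairing of quadratic forms *)

Section Trace.
Context {R : realType}.

Definition qform {n} (A : 'I_n -> 'I_n -> R) (x : 'I_n -> R) : R :=
  \sum_i \sum_j x i * x j * A i j.

Lemma qform_rank1 {n} (r x : 'I_n -> R) :
  qform (fun i j => r i * r j) x = (\sum_i r i * x i) ^+ 2.
Proof.
rewrite expr2 mulr_suml; apply: eq_bigr => i _; rewrite mulr_sumr.
by apply: eq_bigr => j _; ring.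
Qed.

Lemma sum2_ord_recl {n} (F : 'I_n.+1 -> 'I_n.+1 -> R) :
    (forall j, F ord0 j = 0) -> (forall i, F i ord0 = 0) ->
  \sum_i \sum_j F i j = \sum_i \sum_j F (lift ord0 i) (lift ord0 j).
Proof.
move=> F0 F0'; rewrite big_ord_recl [X in X + _]big1 // add0r.
by apply: eq_bigr => i _; rewrite big_ord_recl F0' add0r.
Qed.

Lemma extend_ord0 {n} (x0 : R) (x : 'I_n -> R) :
  exists y : 'I_n.+1 -> R, y ord0 = x0 /\ forall j, y (lift ord0 j) = x j.
Proof.
exists (fun i => if unlift ord0 i is Some j then x j else x0).
by split=> [|j]; rewrite ?unlift_none ?liftK.
Qed.

(* Induction on the dimension through the Schur complement of the entry (0, 0):
   A is the sum of a rank one form, which pairs nonnegatively with H, and of a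
   positive form in one variable less. *)
Lemma posdef_pairing_ge0 {n} (A H : 'I_n -> 'I_n -> R) :
    (forall i j, A i j = A j i) ->
    (forall x : 'I_n -> R, (exists i, x i != 0) -> 0 < qform A x) ->
    (forall x, 0 <= qform H x) ->
  0 <= \sum_i \sum_j A i j * H i j.
Proof.
elim: n A H => [|n IHn] A H At Apos Hpos; first by rewrite big_ord0.
pose a := A ord0 ord0; pose r i := A ord0 i.
have a_gt0 : 0 < a.
  have : 0 < qform A (fun i => (i == ord0)%:R).
    by apply: Apos; exists ord0; rewrite eqxx oner_neq0.
  rewrite /qform (bigD1 ord0) //= [X in _ + X]big1 ?addr0 => [|i /negbTE ->]; last first.
    by rewrite big1 // => j _; rewrite !mul0r.
  rewrite (bigD1 ord0) //= [X in _ + X]big1 ?addr0 => [|i /negbTE ->]; last first.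
    by rewrite mulr0 mul0r.
  by rewrite !mul1r.
pose S i j := A i j - a^-1 * (r i * r j).
have S0 j : S ord0 j = 0 by rewrite /S /r -/a mulKf ?subrr ?gt_eqF.
have S0' i : S i ord0 = 0 by rewrite /S /r (At i) -/a mulrC mulrK ?subrr ?unitfE ?gt_eqF.
have -> : \sum_i \sum_j A i j * H i j =
    a^-1 * qform H r + \sum_i \sum_j S i j * H i j.
  rewrite mulr_sumr -big_split; apply: eq_bigr => i _ /=.
  rewrite mulr_sumr -big_split; apply: eq_bigr => j _ /=.
  by rewrite /S; ring.
rewrite addr_ge0 ?mulr_ge0 ?invr_ge0 ?(ltW a_gt0) //.
rewrite sum2_ord_recl => [|j|i]; rewrite ?S0 ?S0' ?mul0r //.
apply: (IHn (fun i j => S (lift ord0 i) (lift ord0 j))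
            (fun i j => H (lift ord0 i) (lift ord0 j))) => [i j|x [i xi]|x].
- by rewrite /S At (mulrC (r _)).
(* The first coordinate is chosen so that the rank one form vanishes at [y]; there the forms [A] and
   [S] agree. *)
- have [y [y0 yl]] := extend_ord0 (- (a^-1 * \sum_j r (lift ord0 j) * x j)) x.
  have -> : qform (fun i j => S (lift ord0 i) (lift ord0 j)) x = qform S y.
    rewrite /qform sum2_ord_recl => [|j|k]; rewrite ?S0 ?S0' ?mulr0 //.
    by apply: eq_bigr => k _; apply: eq_bigr => j _; rewrite !yl.
  have -> : qform S y = qform A y - a^-1 * qform (fun i j => r i * r j) y.
    rewrite mulr_sumr -sumrB; apply: eq_bigr => k _.
    rewrite mulr_sumr -sumrB; apply: eq_bigr => j _.
    by rewrite /S; ring.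
  have ry : \sum_j r (lift ord0 j) * y (lift ord0 j) = \sum_j r (lift ord0 j) * x j.
    by apply: eq_bigr => j _; rewrite yl.
  rewrite qform_rank1 big_ord_recl y0 mulrN mulVKf ?gt_eqF // ry.
  rewrite addNr expr0n mulr0 subr0; apply: Apos; exists (lift ord0 i).
  by rewrite yl.
- have [y [y0 yl]] := extend_ord0 0 x.
  suff -> : qform (fun i j => H (lift ord0 i) (lift ord0 j)) x = qform H y by [].
  rewrite /qform sum2_ord_recl => [|j|k]; rewrite ?y0 ?mulr0 ?mul0r //.
  by apply: eq_bigr => k _; apply: eq_bigr => j _; rewrite !yl.
Qed.

End Trace.

(** * Functions regular up to the boundary *)

Lemma cvg_bigD {R : realType} {T : Type} {I : finType} (F : set_system T) {FF : Filter F}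
    (f : I -> T -> R) (a : I -> R) :
  (forall i, f i x @[x --> F] --> a i) -> \sum_i f i x @[x --> F] --> \sum_i a i.
Proof.
move=> fa; apply: cvg_big => //; exact: add_continuous.
Qed.

Section UpToBoundary.
Context {R : realType} {n : nat}.
Implicit Types (D : set 'rV[R]_n) (f : 'rV[R]_n -> R) (x y v : 'rV[R]_n).

Lemma pdE D i f x : D x -> pd D i f x = 'D_(delta_mx 0 i) f x.
Proof. by move=> Dx; rewrite /pd /ext ifT // inE. Qed.

Lemma Ck_C1_data k D f s : Ck k D f -> (size s < k)%N ->
  C1_data D (pds D s f) (fun i => pds D (i :: s) f).
Proof.
move=> fk sk; split=> [i x Dx|i].
  rewrite [pds _ (_ :: _) _ _]/= pdE //; apply: derivableP.
  exact: (fk s (ltnW sk)).2.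
apply: continuous_subspaceW (@subset_closure _ D) _.
exact: (fk (i :: s) sk).1.
Qed.

Lemma within_continuous_lin {I : finType} (S : set 'rV[R]_n) (c : I -> R)
    (F : I -> 'rV[R]_n -> R) :
  (forall i, {within S, continuous (F i)}) ->
  {within S, continuous (fun x => \sum_i c i * F i x)}.
Proof.
move=> Fc; apply/subspace_continuousP => x Sx.
apply: cvg_bigD => i; apply: cvgMl_tmp.
by have /subspace_continuousP/(_ x Sx) := Fc i.
Qed.

Lemma within_continuous_line (T : set 'rV[R]_n) (S : set R) f y v :
    {within T, continuous f} -> (forall s, S s -> T (y + s *: v)) ->
  {within S, continuous (fun s => f (y + s *: v))}.
Proof.
move=> fc ST; apply/subspace_continuousP => s Ss.
apply/cvgrPdist_lt => e e_gt0.
have [d d_gt0 dP] := (within_continuous_enorm _ _).1 fc _ (ST s Ss) e e_gt0.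
have V0 : 0 < 1 + enorm v by rewrite ltr_pwDl ?enorm_ge0.
apply/nbhs_ballP; exists (d / (1 + enorm v)) => /=; first exact: divr_gt0.
move=> t; rewrite -ball_normE /= distrC ltr_pdivlMr // => td St; rewrite distrC.
apply: dP; first exact: ST.
rewrite opprD addrACA subrr add0r -scalerBl enormZ; apply: le_lt_trans td.
by apply: ler_wpM2l => //; rewrite lerDr.
Qed.

Lemma dotv_continuous (p : 'rV[R]_n) : continuous (fun x => dotv x p).
Proof.
move=> x; apply: (@cvg_bigD _ _ _ (nbhs x)) => i.
by apply: (@cvgMr_tmp _ _ (nbhs x)); exact: (@coord_continuous R 1 n 0 i x).
Qed.

Lemma dotvv_continuous : continuous (fun x : 'rV[R]_n => dotv x x).
Proof.
move=> x; apply: (@cvg_bigD _ _ _ (nbhs x)) => i.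
by apply: (@cvgM _ _ (nbhs x)); exact: (@coord_continuous R 1 n 0 i x).
Qed.

(** A one-sided condition, since only the directions entering [D] are available. If it failed by
    [m], continuity of the gradient up to the boundary would keep the slope of [f] below
    [- a - m / 2] near [y], and [f] would drop by more than the quadratic term can offset. *)
Lemma first_order_at_boundary D f G y e (a b t0 : R) : open D ->
    C1_data D f G -> {within closure D, continuous f} ->
    (forall i, {within closure D, continuous (G i)}) ->
    closure D y -> 0 < t0 -> (forall t, 0 < t < t0 -> D (y + t *: e)) ->
    (forall t, 0 < t < t0 -> f y <= f (y + t *: e) + a * t + b * t ^+ 2) ->
  - a <= \sum_i e 0 i * G i y.
Proof.
move=> oD fG fc Gc clDy t0_gt0 De fmin; rewrite leNgt; apply/negP => lt.
pose S x := \sum_i e 0 i * G i x; pose m := - a - S y.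
have m_gt0 : 0 < m by rewrite subr_gt0.
have m2_gt0 : 0 < m / 2 by lra.
have Sc : {within closure D, continuous S} by exact: within_continuous_lin.
have [d d_gt0 dP] := (within_continuous_enorm _ _).1 Sc _ clDy _ m2_gt0.
have V0 : 0 < 1 + enorm e by rewrite ltr_pwDl ?enorm_ge0.
have B0 : 0 < 1 + `|b| by rewrite ltr_pwDl.
(* The three bounds keep the segment in [D], keep the slope within [m / 2] of [S y], and make
   [|b| t] smaller than [m / 2]. The added 1 covers [e = 0] and [b = 0]. *)
pose t := Num.min (Num.min t0 (d / (1 + enorm e))) (m / (2 * (1 + `|b|))) / 2.
have M_gt0 : 0 < Num.min (Num.min t0 (d / (1 + enorm e))) (m / (2 * (1 + `|b|))).
  by rewrite !lt_min t0_gt0 !divr_gt0 // mulr_gt0.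
have t_gt0 : 0 < t by rewrite divr_gt0.
have tM : t < Num.min (Num.min t0 (d / (1 + enorm e))) (m / (2 * (1 + `|b|))).
  by rewrite /t; lra.
move: tM; rewrite !lt_min => /andP[/andP[tt0 td]].
rewrite ltr_pdivlMr // in td; rewrite ltr_pdivlMr ?mulr_gt0 // => tb.
have clD s : 0 <= s <= t -> closure D (y + s *: e).
  rewrite le_eqVlt => /andP[/orP[/eqP <-|s0] st]; first by rewrite scale0r addr0.
  by apply: subset_closure; apply: De; rewrite s0 (le_lt_trans st).
have hc : {within `[0, t], continuous (fun s => f (y + s *: e))}.
  by apply: (within_continuous_line fc) => s /=; rewrite in_itv; exact: clD.
have hD s : 0 < s < t -> is_derive s 1 (fun s => f (y + s *: e)) (S (y + s *: e)).
  move=> /andP[s0 st]; apply: C1_line oD fG _.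
  by apply: De; rewrite s0 (lt_trans st).
have [s /andP[s0 st]] := mean_value t_gt0 hD hc.
rewrite scale0r addr0 subr0 => E.
have := fmin t; rewrite t_gt0 => /(_ tt0).
have : `|S (y + s *: e) - S y| < m / 2.
  apply: dP; first by apply: clD; rewrite !ltW.
  rewrite addrAC subrr add0r enormZ gtr0_norm //.
  by apply: le_lt_trans td; rewrite ler_pM ?enorm_ge0 ?ltW // ltr_pwDl.
rewrite ltr_norml => /andP[_ Ss].
have : b * t <= `|b| * t by rewrite ler_wpM2r ?ler_norm ?ltW.
have : S (y + s *: e) < - a - m / 2 by rewrite /m in Ss *; lra.
move: E; move: (f (y + t *: e)) (f y) (S (y + s *: e)) => ft fy Ss' E.
have := normr_ge0 b; nra.
Qed.

Lemma closed_eball x (r : R) : closed [set y | enorm (y - x) <= r].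
Proof.
move=> y cl; rewrite /= leNgt; apply/negP => lt.
have e_gt0 : 0 < enorm (y - x) - r by rewrite subr_gt0.
have [z /= zr zy] := closure_enorm cl e_gt0.
have := enormD (y - z) (z - x); rewrite addrA subrK -(enormN (y - z)) opprB; lra.
Qed.

Lemma penalized_min (S : set 'rV[R]_n) f x0 (r : R) z :
    closed S ->
    {within S, continuous f} -> S z -> enorm (z - x0) <= r ->
  exists y, [/\ S y, enorm (y - x0) <= r &
    forall x, S x -> enorm (x - x0) <= r -> f y <= f x].
Proof.
move=> clS fc Sz zr; pose K := S `&` [set y | enorm (y - x0) <= r].
have [|||y /[!inE] -[Sy yr] ymin] := @EVT_min_rV R n f K.
- by exists z.
- apply: bounded_closed_compact; last by apply: closedI => //; exact: closed_eball.
  exists (r + enorm x0); split; first exact: num_real.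
  move=> M rM v [_ /= vr]; apply: le_trans (norm_le_enorm v) _.
  apply: le_trans (ltW rM); have := enormD (v - x0) x0; rewrite subrK; lra.
- by apply: continuous_subspaceW fc => ? [].
by exists y; split=> // x Sx xr; apply: ymin; rewrite inE.
Qed.

End UpToBoundary.

(** * Boundary charts and normals *)

Section Charts.
Context {R : realType}.

Lemma Ck_le {n} k l (D : set 'rV[R]_n) f : (l <= k)%N -> Ck k D f -> Ck l D f.
Proof.
move=> lk fk s sl; split; first exact: (fk s (leq_trans sl lk)).1.
by move=> sl'; exact: (fk s (leq_trans sl lk)).2 (leq_trans sl' lk).
Qed.

Lemma ler_sum_const {n} (F : 'I_n -> R) c :
  (forall i, F i <= c) -> \sum_i F i <= n%:R * c.
Proof.
by move=> Fc; rewrite mulr_natl -[n in leRHS]card_ord -sumr_const ler_sum.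
Qed.

Lemma Ck_setT_continuous {n} k (f : 'rV[R]_n -> R) :
  Ck k setT f -> {within setT, continuous f}.
Proof. by move=> /(_ [::] isT)[]; rewrite closureT. Qed.

Lemma dotv_orthogonal {n} (Q : 'M[R]_n) (u v : 'rV[R]_n) : Q *m Q^T = 1%:M ->
  dotv (u *m Q) (v *m Q) = dotv u v.
Proof.
by move=> QQ; rewrite !dotvE trmx_mul mulmxA -(mulmxA u) QQ mulmx1.
Qed.

Lemma enorm_orthogonal {n} (Q : 'M[R]_n) (u : 'rV[R]_n) : Q *m Q^T = 1%:M ->
  enorm (u *m Q) = enorm u.
Proof. by move=> QQ; rewrite /enorm dotv_orthogonal. Qed.

Lemma orthogonal_coord {n} (Q : 'M[R]_n) : Q *m Q^T = 1%:M ->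
  forall v : 'rV[R]_n, exists u, v = u *m Q.
Proof.
move=> /mulmx1C QQ v; exists (v *m Q^T).
by rewrite -mulmxA QQ mulmx1.
Qed.

Lemma dotv_join_last {n} (v : 'rV[R]_n.+1) (b : 'rV[R]_n) t :
  dotv v (join_last b t) = dotv (col' ord_max v) b + v 0 ord_max * t.
Proof.
rewrite /dotv (bigD1_ord ord_max) //= addrC mxE unlift_none; congr (_ + _).
by apply: eq_bigr => i _; rewrite !mxE liftK.
Qed.

Lemma col'_join_last {n} (b : 'rV[R]_n) t : col' ord_max (join_last b t) = b.
Proof. by apply/rowP => i; rewrite !mxE liftK. Qed.

Lemma sqr_enorm_split {n} (v : 'rV[R]_n.+1) :
  enorm v ^+ 2 = enorm (col' ord_max v) ^+ 2 + v 0 ord_max ^+ 2.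
Proof.
rewrite !sqr_enorm /dotv (bigD1_ord ord_max) //= addrC expr2; congr (_ + _).
by apply: eq_bigr => i _; rewrite !mxE.
Qed.

Lemma enorm_col' {n} (v : 'rV[R]_n.+1) : enorm (col' ord_max v) <= enorm v.
Proof.
rewrite -ler_sqr ?nnegrE ?enorm_ge0 // [leRHS]sqr_enorm_split lerDl.
exact: sqr_ge0.
Qed.

Lemma C1_direction {n} (g : 'rV[R]_n -> R) z v (e : R) : Ck 1 setT g -> 0 < e ->
  exists2 r, 0 < r & forall t, `|t| < r ->
    `|g (z + t *: v) - g z - t * dotv v (grad setT g z)| <= e * `|t|.
Proof.
move=> g1 e_gt0; have gC : C1_data setT g (fun i => pds setT [:: i] g).
  exact: (@Ck_C1_data _ _ 1 setT g [::] g1 isT).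
have := C1_line (t := 0) (x := z) (v := v) openT gC I.
move=> /is_derive_epsP/(_ e e_gt0)[r r_gt0 rP]; exists r => // t /rP.
rewrite add0r scale0r addr0; congr (`|_ - _ * _| <= _).
by apply: eq_bigr => i _; rewrite mxE.
Qed.

(** A point above the graph would belong to [O]; around a point strictly below it, continuity of [g]
    keeps a whole neighbourhood below, so the point would not be in the closure. The strict bound
    [enorm z < r] leaves room for this neighbourhood in the chart. *)
Lemma graph_chart_boundary {n} (O : set 'rV[R]_n.+1) x0 r Q g z : graph_chart O x0 r Q g ->
    {within setT, continuous g} -> enorm z < r -> boundary O (x0 + z *m Q) ->
  g (col' ord_max z) = z 0 ord_max.
Proof.
move=> [r_gt0 QQ chart] gc zr [clO nO].
apply/eqP; rewrite eq_le andbC; apply/andP; split.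
  by rewrite leNgt; apply/negP => lt; apply: nO; apply/chart; rewrite ?ltW.
rewrite leNgt; apply/negP => lt.
pose m := (g (col' ord_max z) - z 0 ord_max) / 2.
have m_gt0 : 0 < m by rewrite divr_gt0 // subr_gt0.
have [d d_gt0 dP] := (within_continuous_enorm _ _).1 gc (col' ord_max z) I m m_gt0.
have e_gt0 : 0 < Num.min d (Num.min m (r - enorm z)).
  by rewrite !lt_min d_gt0 m_gt0 subr_gt0.
have [y Oy] := closure_enorm clO e_gt0.
have [v vE] := orthogonal_coord QQ (y - (x0 + z *m Q)).
rewrite vE (enorm_orthogonal _ QQ) !lt_min => /andP[vd /andP[vm vr]].
have yE : y = x0 + (z + v) *m Q by rewrite mulmxDl -vE addrA addrC subrK.
have zvr : enorm (z + v) <= r by apply: le_trans (enormD _ _) _; lra.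
move: Oy; rewrite yE => /chart -/(_ zvr).
have -> : col' ord_max (z + v) = col' ord_max z + col' ord_max v.
  by apply/rowP => i; rewrite !mxE.
have := dP (col' ord_max z + col' ord_max v) I.
rewrite addrAC subrr add0r => /(_ (le_lt_trans (enorm_col' _) vd)).
have := le_lt_trans (coord_le_enorm v ord_max) vm.
by rewrite mxE !ltr_norml /m; lra.
Qed.

(** In chart coordinates a negative product with the outer normal says that the direction rises
    faster than the tangent plane of the graph, so a short segment along it lies above the graph. *)
Lemma outer_normal_spec {n} (O : set 'rV[R]_n.+1) y nu : boundary O y ->
    is_outer_normal O y nu ->
  enorm nu = 1 /\ forall e, dotv e nu < 0 ->
    exists2 t0 : R, 0 < t0 & forall t, 0 < t < t0 -> O (y + t *: e).
Proof.
move=> bd [r [Q [g [chart g1 /=]]]]; set w := join_last _ _ => ->.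
have [r_gt0 QQ chartP] := chart.
have w_gt0 : 0 < enorm w.
  rewrite lt_def enorm_ge0 andbT; apply/negP => /eqP w0.
  have := coord_le_enorm w ord_max; rewrite w0 mxE unlift_none normrN normr1.
  by rewrite ler10.
split=> [|e].
  by rewrite enorm_orthogonal // enormZ gtr0_norm ?invr_gt0 // mulVf // gt_eqF.
have [v ->] := orthogonal_coord QQ e.
rewrite dotv_orthogonal // dotvZr pmulr_rlt0 ?invr_gt0 // dotv_join_last mulrN1.
set S := dotv _ _; rewrite subr_lt0 => lt.
pose m := (v 0 ord_max - S) / 2; have m_gt0 : 0 < m by rewrite divr_gt0 // subr_gt0.
have [t1 t1_gt0 t1P] := C1_direction 0 (col' ord_max v) g1 m_gt0.
have V0 : 0 < 1 + enorm v by rewrite ltr_pwDl ?enorm_ge0.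
exists (Num.min t1 (r / (1 + enorm v))); first by rewrite lt_min t1_gt0 divr_gt0.
move=> t; rewrite lt_min => /and3P[t0 tt1]; rewrite ltr_pdivlMr // => tr.
have gc : {within setT, continuous g} by exact: Ck_setT_continuous g1.
have g0 : g 0 = 0.
  have := graph_chart_boundary (z := 0) chart gc.
  have -> : col' ord_max (0 : 'rV[R]_n.+1) = 0 by apply/rowP => i; rewrite !mxE.
  by rewrite mul0mx addr0 enorm0 !mxE => ->.
rewrite scalemxAl; apply/chartP.
  rewrite enormZ gtr0_norm //; apply: le_trans (ltW tr).
  by rewrite ler_wpM2l ?(ltW t0) // lerDr.
have := t1P t; rewrite add0r g0 gtr0_norm // subr0 => /(_ tt1).
have -> : col' ord_max (t *: v) = t *: col' ord_max v by apply/rowP => i; rewrite !mxE.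
rewrite mxE -/S ler_norml => /andP[_]; rewrite /m => le.
have : 0 < t * (v 0 ord_max - S) by rewrite mulr_gt0 // subr_gt0.
lra.
Qed.

Lemma gradient_lipschitz {n} (g : 'rV[R]_n -> R) C z i : Ck 2 setT g ->
    Ck_norm_le 2 setT setT C g ->
  `|pd setT i g z - pd setT i g 0| <= n%:R * C * enorm z.
Proof.
move=> g2 gC; have g2i : C1_data setT (pd setT i g) (fun j => pds setT [:: j; i] g).
  exact: (@Ck_C1_data _ _ 2 setT g [:: i] g2 isT).
have [t _] := @MVT_line R n (pd setT i g)
  (fun t => \sum_j z 0 j * pds setT [:: j; i] g (0 + t *: z)) 0 z
  (fun t _ => C1_line openT g2i I).
rewrite add0r => ->; apply: le_trans (ler_norm_sum _ _ _) _.
rewrite -mulrA; apply: ler_sum_const => j; rewrite normrM mulrC.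
by apply: ler_pM => //; [exact: gC|exact: coord_le_enorm].
Qed.

Lemma gradient_lipschitz_dotv {n} (g : 'rV[R]_n -> R) C z u : Ck 2 setT g ->
    Ck_norm_le 2 setT setT C g ->
  `|dotv u (grad setT g z) - dotv u (grad setT g 0)| <=
    n%:R ^+ 2 * C * enorm z * enorm u.
Proof.
move=> g2 gC; rewrite -sumrB; apply: le_trans (ler_norm_sum _ _ _) _.
have -> : n%:R ^+ 2 * C * enorm z * enorm u =
  n%:R * (n%:R * C * enorm z * enorm u) by ring.
apply: ler_sum_const => j; rewrite !mxE -mulrBr normrM mulrC.
apply: ler_pM => //; last exact: coord_le_enorm.
exact: gradient_lipschitz.
Qed.

(** The mean value theorem gives the gradient at an intermediate point, and the Lipschitz bound of
    the gradient supplies the second factor [enorm z]. *)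
Lemma graph_quadratic_bound {n} (g : 'rV[R]_n -> R) C z : Ck 2 setT g ->
    Ck_norm_le 2 setT setT C g -> 0 <= C ->
  `|g z - g 0 - dotv z (grad setT g 0)| <= n%:R ^+ 2 * C * enorm z ^+ 2.
Proof.
move=> g2 gC C0; have g1 : C1_data setT g (fun i => pds setT [:: i] g).
  exact: (@Ck_C1_data _ _ 2 setT g [::] g2 isT).
have [t /andP[t0 t1]] := @MVT_line R n g
  (fun t => \sum_j z 0 j * pds setT [:: j] g (0 + t *: z)) 0 z
  (fun t _ => C1_line openT g1 I).
rewrite add0r => ->; rewrite -sumrB; apply: le_trans (ler_norm_sum _ _ _) _.
have -> : n%:R ^+ 2 * C * enorm z ^+ 2 =
  n%:R * (n%:R * C * enorm z * enorm z) by ring.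
apply: ler_sum_const => j; rewrite mxE -mulrBr normrM mulrC.
apply: ler_pM => //; last exact: coord_le_enorm.
apply: le_trans (gradient_lipschitz _ _ g2 gC) _; rewrite add0r enormZ ger0_norm //.
rewrite ler_wpM2l ?mulr_ge0 // -[leRHS]mul1r ler_wpM2r ?enorm_ge0 //.
Qed.

(** Here [p] is an inward normal at [x0], not normalised. Nearby boundary points leave its tangent
    plane only quadratically, and [p] remains almost an inward normal there. The last property is
    phrased through directions entering [O], so that it does not depend on the chart defining the
    normal at [y]. The constants do not depend on [x0]. *)
Lemma uniform_normal_field {n} (O : set 'rV[R]_n.+1) : uniformly_C2_domain O ->
  exists P C r : R, [/\ 0 < P, 0 < C, 0 < r & forall x0, boundary O x0 ->
    exists p : 'rV[R]_n.+1, [/\ 1 <= enorm p, enorm p <= P &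
      forall y, boundary O y -> enorm (y - x0) < r ->
        `|dotv (y - x0) p| <= C * enorm (y - x0) ^+ 2 /\
        forall e, (exists2 t0 : R, 0 < t0 & forall t, 0 < t < t0 -> O (y + t *: e)) ->
          - (C * enorm (y - x0) * enorm e) <= dotv p e]].
Proof.
move=> [r [C [r_gt0 C_gt0 charts]]].
exists (1 + n%:R * C), (n%:R ^+ 2 * C + 1), r; split=> //.
- by rewrite ltr_pwDl // mulr_ge0 // ltW.
- by rewrite ltr_wpDl // mulr_ge0 // ?sqr_ge0 // ltW.
move=> x0 bd0; have [Q [g [chart g2 gC]]] := charts x0 bd0.
have [_ QQ chartP] := chart.
have gc : {within setT, continuous g} by exact: Ck_setT_continuous g2.
have g1 : Ck 1 setT g by exact: Ck_le g2.
have g0 : g 0 = 0.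
  have := graph_chart_boundary (z := 0) chart gc.
  have -> : col' ord_max (0 : 'rV[R]_n.+1) = 0 by apply/rowP => i; rewrite !mxE.
  by rewrite mul0mx addr0 enorm0 !mxE => ->.
pose b := grad setT g 0; pose q := join_last (- b) 1.
have qE : enorm q ^+ 2 = enorm b ^+ 2 + 1.
  by rewrite sqr_enorm_split col'_join_last enormN mxE unlift_none expr1n.
have dq v : dotv v q = v 0 ord_max - dotv (col' ord_max v) b.
  by rewrite dotv_join_last mulr1 addrC dotvNr.
have bE : enorm b ^+ 2 <= n%:R * C ^+ 2.
  rewrite sqr_enorm; apply: ler_sum_const => j; rewrite -expr2 -(real_normK (num_real _)).
  rewrite ler_sqr ?nnegrE ?(ltW C_gt0) // mxE; exact: (gC [:: j]).
exists (q *m Q); rewrite enorm_orthogonal //; split.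
- by rewrite -ler_sqr ?nnegrE ?enorm_ge0 // expr1n qE lerDr sqr_ge0.
- rewrite -ler_sqr ?nnegrE ?enorm_ge0 ?addr_ge0 ?mulr_ge0 ?(ltW C_gt0) // qE.
  have : n%:R <= n%:R ^+ 2 :> R.
    by rewrite -natrX ler_nat -[leqLHS]mul1n; case: (n) => // k; rewrite leq_mul2r.
  have : 0 <= n%:R :> R by []; have := sqr_ge0 C; nra.
move=> y; have [z zE] := orthogonal_coord QQ (y - x0).
have -> : y = x0 + z *m Q by rewrite -zE addrC subrK.
rewrite addrAC subrr add0r enorm_orthogonal // => bdy zr.
have gz := graph_chart_boundary chart gc zr bdy.
rewrite dotv_orthogonal //; split.
  rewrite dq -gz; have := graph_quadratic_bound (col' ord_max z) g2 gC (ltW C_gt0).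
  rewrite g0 subr0 => le; apply: le_trans le _; rewrite mulrDl mul1r.
  apply: (@le_trans _ _ (n%:R ^+ 2 * C * enorm z ^+ 2)); last by rewrite lerDl sqr_ge0.
  rewrite ler_wpM2l ?mulr_ge0 ?sqr_ge0 ?(ltW C_gt0) //.
  by rewrite ler_sqr ?nnegrE ?enorm_ge0 // enorm_col'.
move=> e; have [v ->] := orthogonal_coord QQ e; move=> [t0 t0_gt0 t0P].
rewrite enorm_orthogonal // dotvC dotv_orthogonal // dq.
pose S := dotv (col' ord_max v) (grad setT g (col' ord_max z)).
(* If the graph had at [z] a slope along [v] larger than the last coordinate of [v], a short segment
   in this direction would run below the graph, outside [O]. *)
have Sv : S <= v 0 ord_max.
  rewrite leNgt; apply/negP => lt.
  pose m := (S - v 0 ord_max) / 2; have m_gt0 : 0 < m by rewrite divr_gt0 // subr_gt0.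
  have [t1 t1_gt0 t1P] := C1_direction (col' ord_max z) (col' ord_max v) g1 m_gt0.
  have V0 : 0 < 1 + enorm v by rewrite ltr_pwDl ?enorm_ge0.
  pose T := Num.min t0 (Num.min t1 ((r - enorm z) / (1 + enorm v))).
  have T_gt0 : 0 < T by rewrite !lt_min t0_gt0 t1_gt0 divr_gt0 // subr_gt0.
  pose t := T / 2; have t_gt0 : 0 < t by rewrite divr_gt0.
  have : t < T by rewrite /t; lra.
  rewrite !lt_min => /and3P[tt0 tt1]; rewrite ltr_pdivlMr // => tr.
  have := t0P t; rewrite t_gt0 => /(_ tt0); rewrite scalemxAl -addrA -mulmxDl => /chartP.
  have zvr : enorm (z + t *: v) <= r.
    apply: le_trans (enormD _ _) _; rewrite enormZ gtr0_norm //; nra.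
  move=> /(_ zvr); have := t1P t; rewrite gtr0_norm // => /(_ tt1).
  have -> : col' ord_max (z + t *: v) = col' ord_max z + t *: col' ord_max v.
    by apply/rowP => i; rewrite !mxE.
  rewrite -/S gz !mxE ler_norml /m => /andP[le _] lt'.
  have : 0 < t * (S - v 0 ord_max) by rewrite mulr_gt0 // subr_gt0.
  lra.
have SE : `|S - dotv (col' ord_max v) b| <= n%:R ^+ 2 * C * enorm z * enorm v.
  apply: le_trans (gradient_lipschitz_dotv _ _ g2 gC) _.
  have nC : 0 <= n%:R ^+ 2 * C by rewrite mulr_ge0 ?sqr_ge0 // ltW.
  apply: ler_pM; [by rewrite mulr_ge0 ?enorm_ge0|exact: enorm_ge0| |exact: enorm_col'].
  by apply: ler_wpM2l => //; exact: enorm_col'.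
have : 0 <= enorm z * enorm v by rewrite mulr_ge0 ?enorm_ge0.
by move: SE; rewrite ler_norml => /andP[SE _]; lra.
Qed.

End Charts.

(** * Penalized interior minima *)

Section Penalty.
Context {R : realType} {n : nat}.
Implicit Types (x y e p : 'rV[R]_n).

(** With [p] pointing inward, the linear term increases outward. The term in [J] allows completing
    the square, so that the linear term cannot spoil the values on a sphere; [K = J = 0] is the
    radial case. *)
Definition penalty x0 p (K J : R) x : R :=
  dotv (x - x0) (x - x0) - K * dotv (x - x0) p + J * dotv (x - x0) p ^+ 2.

Definition penalty_grad x0 p (K J : R) y : 'rV[R]_n :=
  2 *: (y - x0) + (2 * J * dotv (y - x0) p - K) *: p.

Lemma penalty_gradE x0 p K J y i : penalty_grad x0 p K J y 0 i =
  2 * (y - x0) 0 i + (2 * J * dotv (y - x0) p - K) * p 0 i.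
Proof. by rewrite /penalty_grad; move: (y - x0) (_ - K) => u k; rewrite !mxE. Qed.

(** The expansion is exact, so the penalty provides the coefficients [a] and [b] of the first and
    second order conditions without remainder. *)
Lemma penalty_line x0 p K J y e t : penalty x0 p K J (y + t *: e) =
  penalty x0 p K J y + t * dotv e (penalty_grad x0 p K J y) +
  t ^+ 2 * (dotv e e + J * dotv e p ^+ 2).
Proof.
rewrite /penalty /penalty_grad addrAC.
rewrite !(dotvDl, dotvDr, dotvZl, dotvZr, dotvNl, dotvNr) !(dotvC x0) !(dotvC y e).
by rewrite !(dotvC e x0); ring.
Qed.

Lemma within_continuous_penalty (S : set 'rV[R]_n) x0 p K J f (e : R) :
  {within S, continuous f} ->
  {within S, continuous (fun x => f x + e * penalty x0 p K J x)}.
Proof.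
move=> fc; have pc : {within S, continuous (penalty x0 p K J)}.
  apply: continuous_subspaceT => x.
  have c1 q : (dotv (y - x0) q @[y --> x] --> dotv (x - x0) q).
    have -> : (fun y => dotv (y - x0) q) = (fun y => dotv y q - dotv x0 q).
      by apply/funext => y; rewrite dotvDl dotvNl.
    rewrite dotvDl dotvNl; apply: (@cvgB _ _ _ (nbhs x)); last exact: cvg_cst.
    exact: dotv_continuous.
  have c2 : (dotv (y - x0) (y - x0) @[y --> x] --> dotv (x - x0) (x - x0)).
    have E y : dotv (y - x0) (y - x0) = dotv y y - dotv (y - x0) x0 - dotv y x0.
      by rewrite !(dotvDl, dotvDr, dotvNl, dotvNr) (dotvC x0 y); ring.
    rewrite E (_ : (fun y => _) = fun y => dotv y y - dotv (y - x0) x0 - dotv y x0).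
      apply: (@cvgB _ _ _ (nbhs x)); last exact: dotv_continuous.
      apply: (@cvgB _ _ _ (nbhs x)); last exact: c1.
      exact: dotvv_continuous.
    exact/funext.
  apply: (@cvgD _ _ _ (nbhs x)).
    by apply: (@cvgB _ _ _ (nbhs x)) => //; apply: (@cvgMl_tmp _ _ (nbhs x)); exact: c1.
  apply: (@cvgMl_tmp _ _ (nbhs x)).
  by apply: (@cvgM _ _ (nbhs x)); exact: c1.
apply/subspace_continuousP => x Sx; apply: cvgD.
  by have /subspace_continuousP/(_ x Sx) := fc.
by apply: cvgMl_tmp; have /subspace_continuousP/(_ x Sx) := pc.
Qed.

End Penalty.

Section SecondOrder.
Context {R : realType} {n : nat}.
Implicit Types (D : set 'rV[R]_n) (f : 'rV[R]_n -> R) (x y e p : 'rV[R]_n).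

Definition C2_data D f (G : 'I_n -> 'rV[R]_n -> R)
    (H : 'I_n -> 'I_n -> 'rV[R]_n -> R) :=
  C1_data D f G /\ forall i, C1_data D (G i) (H i).

Lemma is_derive_lin (F : 'I_n -> R -> R) (c d : 'I_n -> R) (x : R) :
  (forall i, is_derive x 1 (F i) (d i)) ->
  is_derive x 1 (fun t => \sum_i c i * F i t) (\sum_i c i * d i).
Proof.
move=> Fd; have -> : (fun t => \sum_i c i * F i t) = \sum_i (c i *: F i).
  by apply/funext => t; rewrite fct_sumE.
by apply: is_derive_sum => i; exact: is_deriveZ.
Qed.

(** Restriction to lines through [y] reduces this to [second_order_min]; coordinate directions give
    the gradient, and all directions together the Hessian bound. *)
Lemma penalized_interior_min D f G H x0 p K J (e : R) y (d : R) :
    open D -> C2_data D f G H -> D y -> 0 < d ->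
    (forall x, D x -> enorm (x - y) < d ->
      f y + e * penalty x0 p K J y <= f x + e * penalty x0 p K J x) ->
  (forall i, G i y = - (e * penalty_grad x0 p K J y 0 i)) /\
  (forall v : 'I_n -> R, - (2 * e * (\sum_i v i ^+ 2 + J * (\sum_i v i * p 0 i) ^+ 2))
     <= qform (fun i j => H i j y) v).
Proof.
move=> oD [fG GH] Dy d_gt0 ymin; have [r r_gt0 rP] := open_enorm oD Dy.
have main (v : 'rV[R]_n) : \sum_i v 0 i * G i y = - (e * dotv v (penalty_grad x0 p K J y)) /\
    - (2 * (e * (dotv v v + J * dotv v p ^+ 2))) <= qform (fun i j => H i j y) (v 0).
  have V0 : 0 < 1 + enorm v by rewrite ltr_pwDl ?enorm_ge0.
  pose r' := Num.min r d / (1 + enorm v).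
  have r'_gt0 : 0 < r' by rewrite divr_gt0 // lt_min r_gt0.
  have small (t : R) : `|t| < r' -> enorm (y + t *: v - y) < Num.min r d.
    rewrite ltr_pdivlMr // addrAC subrr add0r enormZ => le; apply: le_lt_trans le.
    by rewrite ler_wpM2l // lerDr.
  have inD (t : R) : `|t| < r' -> D (y + t *: v).
    by move=> /small; rewrite lt_min => /andP[/rP].
  have [|||E le] := @second_order_min R (fun t => f (y + t *: v))
    (fun t => \sum_i v 0 i * G i (y + t *: v)) (qform (fun i j => H i j y) (v 0))
    (e * dotv v (penalty_grad x0 p K J y))
    (e * (dotv v v + J * dotv v p ^+ 2)) r' r'_gt0.
  - by move=> t tr; apply: C1_line oD fG (inD _ tr).
  - have -> : qform (fun i j => H i j y) (v 0) =
        \sum_i v 0 i * \sum_j v 0 j * H i j (y + 0 *: v).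
      apply: eq_bigr => i _; rewrite mulr_sumr; apply: eq_bigr => j _.
      by rewrite scale0r addr0 mulrA.
    apply: is_derive_lin => i; apply: C1_line oD (GH i) _.
    by rewrite scale0r addr0.
  - move=> t tr; have := small t tr; rewrite lt_min => /andP[_ td].
    have := ymin _ (inD t tr) td; rewrite penalty_line scale0r addr0; lra.
  split=> //; rewrite -E; apply: eq_bigr => i _; by rewrite scale0r addr0.
split=> [i|v].
  have [E _] := main (delta_mx 0 i); move: E.
  have sel (F : 'I_n -> R) : \sum_j (delta_mx 0 i : 'rV[R]_n) 0 j * F j = F i.
    rewrite (bigD1 i) //= mxE !eqxx mul1r big1 ?addr0 // => j /negbTE ji.
    by rewrite mxE eqxx ji mul0r.
  by rewrite /dotv !sel.
have [_] := main (\row_i v i).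
have -> : qform (fun i j => H i j y) ((\row_i v i) 0) = qform (fun i j => H i j y) v.
  by apply: eq_bigr => i _; apply: eq_bigr => j _; rewrite !mxE.
have -> : dotv (\row_i v i) (\row_i v i) = \sum_i v i ^+ 2.
  by apply: eq_bigr => i _; rewrite mxE expr2.
have -> : dotv (\row_i v i) p = \sum_i v i * p 0 i.
  by apply: eq_bigr => i _; rewrite mxE.
by rewrite mulrA.
Qed.

End SecondOrder.

(** * The elliptic operator at a point, as an expression in the value, gradient and Hessian *)

Section Operator.
Context {R : realType}.

(** The divergence is expanded by the product rule, [da i j] standing for the derivative of [a i j]
    in the variable [i]. Working with numbers lets the conditions at a minimum be substituted
    directly. *)
Definition op_at {n} (a da : 'I_n -> 'I_n -> R) (b : 'I_n -> R) (c w : R)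
    (G : 'I_n -> R) (H : 'I_n -> 'I_n -> R) : R :=
  - (\sum_i \sum_j (da i j * G j + a i j * H j i)) - (\sum_i b i * G i) - c * w.

Lemma op_at_lin {n} (a da : 'I_n -> 'I_n -> R) b c k w1 w2 G1 G2 H1 H2 :
  op_at a da b c (k * w1 - w2) (fun i => k * G1 i - G2 i)
    (fun i j => k * H1 i j - H2 i j) =
  k * op_at a da b c w1 G1 H1 - op_at a da b c w2 G2 H2.
Proof.
rewrite /op_at.
have -> : \sum_i \sum_j (da i j * (k * G1 j - G2 j) + a i j * (k * H1 j i - H2 j i)) =
  k * (\sum_i \sum_j (da i j * G1 j + a i j * H1 j i))
  - \sum_i \sum_j (da i j * G2 j + a i j * H2 j i).
  rewrite mulr_sumr -sumrB; apply: eq_bigr => i _.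
  by rewrite mulr_sumr -sumrB; apply: eq_bigr => j _; ring.
have -> : \sum_i b i * (k * G1 i - G2 i) =
    k * (\sum_i b i * G1 i) - \sum_i b i * G2 i.
  by rewrite mulr_sumr -sumrB; apply: eq_bigr => i _; ring.
by ring.
Qed.

Lemma norm_sum_le {n} (F : 'I_n -> R) M :
  (forall i, `|F i| <= M) -> `|\sum_i F i| <= n%:R * M.
Proof.
by move=> FM; apply: le_trans (ler_norm_sum _ _ _) _; exact: ler_sum_const.
Qed.

Lemma sum2_const_sub {n} (c : R) (F : 'I_n -> 'I_n -> R) :
  \sum_i \sum_j (c - F i j) = n%:R * (n%:R * c) - \sum_i \sum_j F i j.
Proof.
have cst (a : R) : n%:R * a = \sum_(i < n) a by rewrite sumr_const card_ord mulr_natl.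
rewrite !cst -sumrB; apply: eq_bigr => i _.
by rewrite sumrB.
Qed.

(** Adding [2 e] times the matrix [m = I + J p p^T] makes [H] a nonnegative form, whose pairing with
    [a] is nonnegative. The second order part is thus at most [2 e] times the pairing of [a] with
    [m]; the gradient terms are also of order [e], and only [c w] remains. *)
Lemma op_at_penalized_le {n} (a da : 'I_n -> 'I_n -> R) (b : 'I_n -> R)
    (c w M e J P D : R) (p d : 'I_n -> R) (H : 'I_n -> 'I_n -> R) :
    (forall i j, a i j = a j i) ->
    (forall x : 'I_n -> R, (exists i, x i != 0) -> 0 < qform a x) ->
    (forall i j, `|a i j| <= M) -> (forall i j, `|da i j| <= M) ->
    (forall i, `|b i| <= M) -> `|c| <= M -> 0 <= e -> 0 <= J ->
    (forall i, `|p i| <= P) -> (forall i, `|d i| <= D) ->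
    (forall v : 'I_n -> R,
       - (2 * e * (\sum_i v i ^+ 2 + J * (\sum_i v i * p i) ^+ 2)) <= qform H v) ->
  op_at a da b c w (fun i => - (e * d i)) H <=
    e * (n%:R * (n%:R * (2 * (M * (1 + J * P ^+ 2)) + M * D)) + n%:R * (M * D))
    + M * `|w|.
Proof.
move=> asym apos aM daM bM cM e0 J0 pP dD Hle.
pose m i j : R := (i == j)%:R + J * (p i * p j).
have M0 : 0 <= M by exact: le_trans cM.
have qE v : qform (fun i j => H j i + 2 * e * m i j) v =
    qform H v + 2 * e * (\sum_i v i ^+ 2 + J * (\sum_i v i * p i) ^+ 2).
  have -> : \sum_i v i ^+ 2 = \sum_i \sum_j v i * v j * (i == j)%:R.
    apply: eq_bigr => i _; rewrite (bigD1 i) //= eqxx mulr1 big1 ?addr0 // => j ji.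
    by rewrite eq_sym (negbTE ji) mulr0.
  have -> : (\sum_i v i * p i) ^+ 2 = \sum_i \sum_j v i * v j * (p i * p j).
    rewrite -qform_rank1; apply: eq_bigr => i _; apply: eq_bigr => j _; ring.
  have -> : qform H v = \sum_i \sum_j v i * v j * H j i.
    by rewrite /qform exchange_big; apply: eq_bigr => i _; apply: eq_bigr => j _; ring.
  rewrite mulrDr !mulr_sumr -!big_split; apply: eq_bigr => i _ /=.
  rewrite !mulr_sumr -!big_split; apply: eq_bigr => j _ /=.
  by rewrite /m; ring.
have tr0 : 0 <= \sum_i \sum_j a i j * (H j i + 2 * e * m i j).
  by apply: posdef_pairing_ge0 => // v; rewrite qE; have := Hle v; lra.
have P2 i j : `|p i * p j| <= P ^+ 2.
  by rewrite normrM expr2 ler_pM.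
have term i j : - (da i j * - (e * d j) + a i j * H j i)
    <= e * (2 * (M * (1 + J * P ^+ 2)) + M * D) - a i j * (H j i + 2 * e * m i j).
  have h1 : `|da i j * d j| <= M * D by rewrite normrM ler_pM.
  have h2 : `|a i j * m i j| <= M * (1 + J * P ^+ 2).
    rewrite normrM ler_pM //; apply: le_trans (ler_normD _ _) _.
    rewrite lerD //; first by case: (i == j); rewrite ?normr1 ?normr0.
    by rewrite normrM ger0_norm // ler_wpM2l.
  have := ler_wpM2l e0 (le_trans (ler_norm _) h1).
  have := ler_wpM2l e0 (le_trans (ler_norm _) h2); lra.
have h3 : - \sum_i \sum_j (da i j * - (e * d j) + a i j * H j i) <=
    e * (n%:R * (n%:R * (2 * (M * (1 + J * P ^+ 2)) + M * D))).
  apply: (@le_trans _ _ (\sum_(i < n) \sum_(j < n)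
      (e * (2 * (M * (1 + J * P ^+ 2)) + M * D) - a i j * (H j i + 2 * e * m i j)))).
    rewrite -sumrN; apply: ler_sum => i _; rewrite -sumrN; apply: ler_sum => j _.
    exact: term.
  rewrite sum2_const_sub lerBlDr.
  have -> : n%:R * (n%:R * (e * (2 * (M * (1 + J * P ^+ 2)) + M * D))) =
    e * (n%:R * (n%:R * (2 * (M * (1 + J * P ^+ 2)) + M * D))) by ring.
  by rewrite lerDl.
have h4 : - (\sum_i b i * - (e * d i)) <= e * (n%:R * (M * D)).
  rewrite -sumrN; have -> : e * (n%:R * (M * D)) = n%:R * (e * (M * D)) by ring.
  apply: ler_sum_const => i.
  have h : `|b i * d i| <= M * D by rewrite normrM ler_pM.
  have := ler_wpM2l e0 (le_trans (ler_norm _) h); lra.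
have h5 : - (c * w) <= M * `|w|.
  rewrite -mulNr; apply: le_trans (ler_norm _) _; rewrite normrM normrN.
  by rewrite ler_wpM2r.
by rewrite /op_at; lra.
Qed.

Lemma is_derive_sumM {n m} (a b : 'I_m -> 'rV[R]_n -> R) (da db : 'I_m -> R) x v :
    (forall j, is_derive x v (a j) (da j)) -> (forall j, is_derive x v (b j) (db j)) ->
  is_derive x v (fun y => \sum_j a j y * b j y) (\sum_j (da j * b j x + a j x * db j)).
Proof.
move=> aP bP; have -> : (fun y => \sum_j a j y * b j y) = \sum_j (a j * b j).
  by apply/funext => y; rewrite fct_sumE.
apply: is_derive_sum => j; apply: is_derive_eq (is_deriveM (aP j) (bP j)) _.
by rewrite addrC -[b j x *: _]/(b j x * _) mulrC.
Qed.

Lemma elliptic_opE {n} (O : set 'rV[R]_n.+1) (A : 'rV[R]_n.+1 -> 'M[R]_n.+1) B c u x :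
    open O ->
    (forall i j, Ck 1 O (fun y => A y i j)) -> Ck 2 O u -> O x ->
  elliptic_op O A B c u x =
  op_at (A x) (fun i j => pd O i (fun y => A y i j) x) (B x 0) (c x) (u x)
    (fun j => pd O j u x) (fun j i => pd O i (pd O j u) x).
Proof.
move=> oO A1 u2 Ox; rewrite /elliptic_op /op_at.
have -> : dotv (B x) (grad O u x) = \sum_i B x 0 i * pd O i u x.
  by apply: eq_bigr => i _; rewrite [grad _ _ _ _ _]mxE.
congr (- _ - _ - _); apply: eq_bigr => i _; rewrite pdE //.
have -> : (fun y => flux O A u y 0 i) = (fun y => \sum_j A y i j * pd O j u y).
  by apply/funext => y; rewrite !mxE; apply: eq_bigr => j _; rewrite !mxE.
have dA j : is_derive x (delta_mx 0 i) (fun y => A y i j) (pd O i (fun y => A y i j) x).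
  exact: (@Ck_C1_data _ _ 1 O _ [::] (A1 i j) isT).1.
have du j : is_derive x (delta_mx 0 i) (pd O j u) (pd O i (pd O j u) x).
  exact: (@Ck_C1_data _ _ 2 O _ [:: j] u2 isT).1.
by have [_ ->] := is_derive_sumM dA du.
Qed.

End Operator.

(** * Penalized minima lie on the boundary *)

(** The threshold [e0] is fixed before [x0], [p] and [z]; this makes the resulting lower bounds for
    [w] uniform over an unbounded domain. *)
Definition minima_at_boundary {R : realType} {n} (O : set 'rV[R]_n.+1)
    (w : 'rV[R]_n.+1 -> R) := forall P K J r mu : R,
    0 <= P -> 0 <= K -> 0 <= J -> 0 < r <= 1 -> 0 < mu ->
  exists2 e0, 0 < e0 & forall (e : R) x0 p z, 0 < e <= e0 -> enorm p <= P -> O z ->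
    enorm (z - x0) <= r ->
    (forall x, enorm (x - x0) = r -> mu <= penalty x0 p K J x) ->
    w z + e * penalty x0 p K J z < e * mu ->
  exists y, [/\ boundary O y, enorm (y - x0) < r &
    forall x, closure O x -> enorm (x - x0) <= r ->
      w y + e * penalty x0 p K J y <= w x + e * penalty x0 p K J x].

Section PenalizedMinimum.
Context {R : realType} {n : nat} (O : set 'rV[R]_n.+1).
Context (w : 'rV[R]_n.+1 -> R) (G : 'I_n.+1 -> 'rV[R]_n.+1 -> R).
Context (H : 'I_n.+1 -> 'I_n.+1 -> 'rV[R]_n.+1 -> R).
Context (a da : 'rV[R]_n.+1 -> 'I_n.+1 -> 'I_n.+1 -> R).
Context (b : 'rV[R]_n.+1 -> 'I_n.+1 -> R) (c : 'rV[R]_n.+1 -> R) (M m : R).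
Hypothesis oO : open O.
Hypothesis wC2 : C2_data O w G H.
Hypothesis wc : {within closure O, continuous w}.
Hypothesis w_ge0 : forall x, closure O x -> 0 <= w x.
Hypothesis asym : forall x, O x -> forall i j, a x i j = a x j i.
Hypothesis apos : forall x, O x -> forall v : 'I_n.+1 -> R,
  (exists i, v i != 0) -> 0 < qform (a x) v.
Hypothesis aM : forall x, O x -> forall i j, `|a x i j| <= M.
Hypothesis daM : forall x, O x -> forall i j, `|da x i j| <= M.
Hypothesis bM : forall x, O x -> forall i, `|b x i| <= M.
Hypothesis cM : forall x, O x -> `|c x| <= M.
Hypothesis m_gt0 : 0 < m.
Hypothesis op_ge : forall x, O x ->
  m <= op_at (a x) (da x) (b x) (c x) (w x) (fun i => G i x) (fun i j => H i j x).

Lemma interior_min_bound (P K J : R) : 0 <= P -> 0 <= K -> 0 <= J ->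
  exists2 E, 0 <= E & forall (x0 p : 'rV[R]_n.+1) (e : R) y (d : R),
    O y -> enorm (y - x0) <= 1 -> enorm p <= P -> 0 <= e -> 0 < d ->
    (forall x, O x -> enorm (x - y) < d ->
      w y + e * penalty x0 p K J y <= w x + e * penalty x0 p K J x) ->
    m <= e * E + M * w y.
Proof.
(* [D] bounds the coordinates of the penalty gradient within distance 1 of [x0]. *)
move=> P0 K0 J0; pose D := 2 + (2 * J * P + K) * P.
have D0 : 0 <= D by rewrite addr_ge0 // mulr_ge0 // addr_ge0 // !mulr_ge0.
pose E := `|n.+1%:R * (n.+1%:R * (2 * (M * (1 + J * P ^+ 2)) + M * D)) + n.+1%:R * (M * D)|.
exists E; first exact: normr_ge0.
move=> x0 p e y d Oy y1 pP e0 d_gt0 ymin.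
have [GE Hge] := penalized_interior_min oO wC2 Oy d_gt0 ymin.
have sP : `|dotv (y - x0) p| <= P.
  apply: le_trans (cauchy_schwarz _ _) _; rewrite -[leRHS]mul1r.
  by rewrite ler_pM ?enorm_ge0.
have dD i : `|penalty_grad x0 p K J y 0 i| <= D.
  rewrite penalty_gradE; apply: le_trans (ler_normD _ _) _.
  apply: lerD.
    rewrite normrM ger0_norm // -[leRHS]mulr1 ler_wpM2l //.
    exact: le_trans (coord_le_enorm _ i) y1.
  rewrite normrM ler_pM //; last exact: le_trans (coord_le_enorm p i) pP.
  apply: le_trans (ler_normB _ _) _; rewrite (ger0_norm K0) lerD2r.
  by rewrite normrM ger0_norm ?mulr_ge0 // ler_wpM2l ?mulr_ge0.
have pP' i : `|p 0 i| <= P by exact: le_trans (coord_le_enorm p i) pP.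
have := op_at_penalized_le (w y) (asym Oy) (apos Oy) (aM Oy) (daM Oy) (bM Oy)
  (cM Oy) e0 J0 pP' dD Hge.
rewrite (ger0_norm (w_ge0 (subset_closure Oy))) => le.
have := op_ge Oy.
rewrite (_ : (fun i => G i y) = fun i => - (e * penalty_grad x0 p K J y 0 i)); last exact/funext.
move=> /le_trans/(_ le)/le_trans; apply.
by rewrite lerD2r ler_wpM2l // ler_norm.
Qed.

Lemma penalized_boundary_min : minima_at_boundary O w.
Proof.
move=> P K J r mu. move=> P0 K0 J0 /andP[r_gt0 r1] mu_gt0.
have [E E0 EP] := interior_min_bound P0 K0 J0.
have [[x1 Ox1]|noO] := pselect (exists x, O x); last first.
  by exists 1 => // e x0 p z _ _ Oz; case: noO; exists z.
have M0 : 0 <= M by exact: le_trans (cM Ox1).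
(* At the minimum the penalty is at least [- K P], so [w] is at most [e (mu + K P)]. For
   [e <= m / (2 T)] the bound [m <= e E + M w] of an interior minimum then fails. *)
pose T := E + M * (mu + K * P) + 1.
have T_gt0 : 0 < T.
  by rewrite ltr_wpDl // addr_ge0 // mulr_ge0 // addr_ge0 ?mulr_ge0 ?(ltW mu_gt0).
exists (m / (2 * T)); first by rewrite divr_gt0 // mulr_gt0.
move=> e x0 p z /andP[e_gt0]; rewrite ler_pdivlMr ?mulr_gt0 // => eT pP Oz zr sph val.
have clOz := subset_closure Oz.
have [y [clOy yr ymin]] := @penalized_min R n.+1 (closure O)
  (fun x => w x + e * penalty x0 p K J x) x0 r z (@closed_closure _ O)
  (@within_continuous_penalty R n.+1 (closure O) x0 p K J w e wc) clOz zr.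
have yz := ymin z clOz zr.
(* On the sphere the penalized value is at least [e mu], which exceeds the value at [z]. *)
have {}yr : enorm (y - x0) < r.
  rewrite lt_neqAle yr andbT; apply/eqP => /sph.
  rewrite -(ler_pM2l e_gt0) => le; have := w_ge0 clOy; lra.
exists y; split=> //; split=> // Oy.
have d_gt0 : 0 < r - enorm (y - x0) by rewrite subr_gt0.
have ym x : O x -> enorm (x - y) < r - enorm (y - x0) ->
    w y + e * penalty x0 p K J y <= w x + e * penalty x0 p K J x.
  move=> Ox xy; apply: ymin; first exact: subset_closure.
  by have := enormD (x - y) (y - x0); rewrite addrA subrK; lra.
have := EP x0 p e y _ Oy (ltW (lt_le_trans yr r1)) pP (ltW e_gt0) d_gt0 ym.
have s_le : dotv (y - x0) p <= P.
  apply: le_trans (ler_norm _) _; apply: le_trans (cauchy_schwarz _ _) _.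
  by rewrite -[leRHS]mul1r ler_pM ?enorm_ge0 // (le_trans (ltW yr)).
have pen_ge : - (K * P) <= penalty x0 p K J y.
  have := ler_wpM2l K0 s_le; have := dotv_ge0 (y - x0).
  by have := mulr_ge0 J0 (sqr_ge0 (dotv (y - x0) p)); rewrite /penalty; lra.
have wy : w y <= e * (mu + K * P).
  by have := ler_wpM2l (ltW e_gt0) pen_ge; lra.
have := ler_wpM2l M0 wy; rewrite /T in eT; have := m_gt0; nra.
Qed.

End PenalizedMinimum.

(** * Boundary conditions *)

Section LowerBounds.
Context {R : realType} {n : nat} (O : set 'rV[R]_n.+1).
Context (w : 'rV[R]_n.+1 -> R).
Hypothesis w_min : minima_at_boundary O w.

Lemma penalty0 x0 (x : 'rV[R]_n.+1) : penalty x0 0 0 0 x = enorm (x - x0) ^+ 2.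
Proof. by rewrite /penalty !mul0r subr0 addr0 sqr_enorm. Qed.

(** The radial penalty centred at [z] vanishes there and equals [r^2] on the sphere; a smaller [w z]
    would force a boundary point within distance [r]. *)
Lemma lower_bound_away_from_boundary (r : R) : 0 < r <= 1 ->
  exists2 e, 0 < e & forall z, O z ->
    (forall y, boundary O y -> r <= enorm (y - z)) -> e <= w z.
Proof.
move=> r01; have [r_gt0 _] := andP r01.
have r2 : 0 < r ^+ 2 by rewrite exprn_gt0.
have [e0 e0_gt0 e0P] := w_min (lexx 0) (lexx 0) (lexx 0) r01 r2.
exists (e0 * r ^+ 2); first exact: mulr_gt0.
move=> z Oz far; rewrite leNgt; apply/negP => lt.
have [|||x xr||y [bdy]] := e0P e0 z 0 z _ _ Oz.
- by rewrite e0_gt0 lexx.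
- by rewrite enorm0.
- by rewrite subrr enorm0 ltW.
- by rewrite penalty0 xr.
- by rewrite penalty0 subrr enorm0 expr0n mulr0 addr0.
by rewrite ltNge far.
Qed.

(** The Dirichlet case: with the radial penalty centred at [z], a boundary minimum [y] would satisfy
    [w y <= w z < k]. *)
Lemma lower_bound_of_boundary (k : R) : 0 < k ->
    (forall y, boundary O y -> k <= w y) ->
  exists2 e, 0 < e & forall z, O z -> e <= w z.
Proof.
move=> k_gt0 wk.
have r01 : 0 < (1 : R) <= 1 by rewrite ltr01 lexx.
have [e0 e0_gt0 e0P] := w_min (lexx 0) (lexx 0) (lexx 0) r01 ltr01.
pose e := Num.min e0 k; have e_gt0 : 0 < e by rewrite lt_min e0_gt0.
exists e => // z Oz; rewrite leNgt; apply/negP => lt.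
have [|||x xr||y [bdy _ ymin]] := e0P e z 0 z _ _ Oz.
- by rewrite e_gt0 ge_min lexx.
- by rewrite enorm0.
- by rewrite subrr enorm0.
- by rewrite penalty0 xr expr1n.
- by rewrite penalty0 subrr enorm0 expr0n mulr0 addr0 mulr1.
have := ymin z (subset_closure Oz); rewrite !penalty0 subrr enorm0 expr0n mulr0 addr0.
move=> /(_ ler01) le.
have : e <= k by rewrite ge_min lexx orbT.
have := wk y bdy; have := mulr_ge0 (ltW e_gt0) (sqr_ge0 (enorm (y - z))); lra.
Qed.

Context (G : 'I_n.+1 -> 'rV[R]_n.+1 -> R).
Context (nu N : 'rV[R]_n.+1 -> 'rV[R]_n.+1) (gamma : 'rV[R]_n.+1 -> R).
Context (a0 L C : R).
Hypothesis oO : open O.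
Hypothesis O_C2 : uniformly_C2_domain O.
Hypothesis wG : C1_data O w G.
Hypothesis wc : {within closure O, continuous w}.
Hypothesis Gc : forall i, {within closure O, continuous (G i)}.
Hypothesis nuP : forall y, boundary O y -> is_outer_normal O y (nu y).
Hypothesis a0_gt0 : 0 < a0.
Hypothesis N_oblique : forall y, boundary O y -> a0 <= dotv (N y) (nu y).
Hypothesis N_bounded : forall y, boundary O y -> enorm (N y) <= L.
Hypothesis gamma_bounded : forall y, boundary O y -> `|gamma y| <= C.
Hypothesis w_ge0 : forall x, closure O x -> 0 <= w x.
Hypothesis robin : forall y, boundary O y ->
  0 <= \sum_i N y 0 i * G i y + gamma y * w y.

(** The direction [- N y - t p] still enters [O] when [t P = a0 / 2]. Testing the almost inward
    normal [p] with it gives [- p . N - t |p|^2 >= - t / 2] close to [x0], and [|p| >= 1] yields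
    [p . N <= - t / 2]. *)
Lemma oblique_field : exists P a1 C1 r : R, [/\ 0 < P, 0 < a1, 0 < C1, 0 < r &
  forall x0, boundary O x0 -> exists2 p : 'rV[R]_n.+1, enorm p <= P &
    forall y, boundary O y -> enorm (y - x0) < r ->
      `|dotv (y - x0) p| <= C1 * enorm (y - x0) ^+ 2 /\ dotv p (N y) <= - a1].
Proof.
have [P [C1 [r [P_gt0 C1_gt0 r_gt0 H]]]] := uniform_normal_field O_C2.
pose t := a0 / (2 * P); have t_gt0 : 0 < t by rewrite divr_gt0 // mulr_gt0.
have tP : t * P = a0 / 2 by rewrite /t invfM mulrA divfK // gt_eqF.
pose Q := C1 * (`|L| + a0 / 2) + 1.
have Q_gt0 : 0 < Q by rewrite ltr_wpDl // mulr_ge0 ?(ltW C1_gt0) // addr_ge0 // divr_ge0 // ltW.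
exists P, (t / 2), C1, (Num.min r (t / (2 * Q))); split=> //; first by rewrite divr_gt0.
  by rewrite lt_min r_gt0 divr_gt0 // mulr_gt0.
move=> x0 /H[p [p1 pP pH]]; exists p => // y bdy; rewrite lt_min => /andP[yr].
rewrite ltr_pdivlMr ?mulr_gt0 // => yt.
have [sle pe] := pH y bdy yr; split=> //.
have [nu1 inward] := outer_normal_spec bdy (nuP bdy).
pose e := - (N y) - t *: p.
have pnu : `|dotv p (nu y)| <= P.
  by apply: le_trans (cauchy_schwarz _ _) _; rewrite nu1 mulr1.
have enu : dotv e (nu y) < 0.
  rewrite dotvDl !dotvNl dotvZl; have := N_oblique bdy.
  move: pnu; rewrite ler_norml => /andP[pnu _].
  have := ler_wpM2l (ltW t_gt0) pnu; rewrite mulrN tP; have := a0_gt0; lra.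
have eL : enorm e <= `|L| + a0 / 2.
  apply: le_trans (enormD _ _) _; rewrite !enormN enormZ gtr0_norm // -tP lerD //.
    exact: le_trans (N_bounded bdy) (ler_norm _).
  by rewrite ler_wpM2l // ltW.
have := pe e (inward e enu).
rewrite dotvDr !dotvNr dotvZr -sqr_enorm.
have : C1 * enorm (y - x0) * enorm e <= t / 2.
  apply: (@le_trans _ _ (enorm (y - x0) * Q)); last lra.
  rewrite mulrAC mulrC ler_wpM2l ?enorm_ge0 // /Q.
  by have := ler_wpM2l (ltW C1_gt0) eL; lra.
have : t <= t * enorm p ^+ 2 by rewrite ler_peMr ?exprn_ege1 // ltW.
lra.
Qed.

(** The first order condition along the entering direction [- N y] bounds [e] times the derivative
    of the penalty along [N] by minus that of [w], which is at most [gamma w] by the Robin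
    inequality. *)
Lemma boundary_min_gradient x0 p K J e y (r : R) : boundary O y -> enorm (y - x0) < r ->
    (forall x, closure O x -> enorm (x - x0) <= r ->
      w y + e * penalty x0 p K J y <= w x + e * penalty x0 p K J x) ->
  e * dotv (N y) (penalty_grad x0 p K J y) <= C * w y.
Proof.
move=> bdy yr ymin; have [clOy nOy] := bdy.
have [nu1 inward] := outer_normal_spec bdy (nuP bdy).
have [t1 t1_gt0 t1P] : exists2 t0 : R, 0 < t0 &
    forall t, 0 < t < t0 -> O (y + t *: - N y).
  apply: inward; rewrite dotvNl oppr_lt0; exact: lt_le_trans (N_oblique bdy).
have V0 : 0 < 1 + enorm (N y) by rewrite ltr_pwDl ?enorm_ge0.
pose t0 := Num.min t1 ((r - enorm (y - x0)) / (1 + enorm (N y))).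
have t0_gt0 : 0 < t0 by rewrite lt_min t1_gt0 divr_gt0 // subr_gt0.
have De t : 0 < t < t0 -> O (y + t *: - N y).
  by rewrite lt_min => /and3P[t_gt0 tt1 _]; apply: t1P; rewrite t_gt0.
have := @first_order_at_boundary R n.+1 O w G y (- N y)
  (e * dotv (- N y) (penalty_grad x0 p K J y))
  (e * (dotv (- N y) (- N y) + J * dotv (- N y) p ^+ 2)) t0 oO wG wc Gc clOy t0_gt0 De.
have fmin t : 0 < t < t0 -> w y <= w (y + t *: - N y)
    + e * dotv (- N y) (penalty_grad x0 p K J y) * t
    + e * (dotv (- N y) (- N y) + J * dotv (- N y) p ^+ 2) * t ^+ 2.
  move=> tt; have tr : enorm (y + t *: - N y - x0) <= r.
    move: tt; rewrite lt_min ltr_pdivlMr // => /and3P[t_gt0 _ tr].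
    rewrite addrAC; apply: le_trans (enormD _ _) _.
    by rewrite enormZ enormN gtr0_norm //; lra.
  have := ymin _ (subset_closure (De _ tt)) tr; rewrite penalty_line; lra.
move=> /(_ fmin); rewrite dotvNl mulrN opprK => le.
have NG : \sum_i (- N y) 0 i * G i y = - \sum_i N y 0 i * G i y.
  by rewrite -sumrN; apply: eq_bigr => i _; rewrite mxE mulNr.
have : gamma y * w y <= C * w y.
  rewrite ler_wpM2r ?w_ge0 //; exact: le_trans (ler_norm _) (gamma_bounded bdy).
by have := robin bdy; lra.
Qed.

(* With K = k r and J = k^2 / 2 the penalty |x|^2 - K s + J s^2 is at least
   |x|^2 - r^2 / 2 whatever s is, while the oblique derivative -K (p . N) of its
   linear part dominates that of |x|^2 on the ball of radius r for large k. *)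
Lemma lower_bound_oblique : exists2 e, 0 < e & forall z, O z -> e <= w z.
Proof.
have [P [a1 [C1 [r0 [P_gt0 a1_gt0 C1_gt0 r0_gt0 field]]]]] := oblique_field.
(* Half of the oblique derivative of the linear term is then [(2 |L| + 1) r], which leaves [r] after
   absorbing the contribution [2 |L| r] of the quadratic [|x|^2]. *)
have [k k_gt0 ka1] : exists2 k, 0 < k & k * a1 = 2 * (2 * `|L| + 1).
  exists (2 * (2 * `|L| + 1) / a1); last by rewrite divfK ?gt_eqF.
  by rewrite divr_gt0 // mulr_gt0 // ltr_wpDl // mulr_ge0.
have [B B1 CB] : exists2 B, 1 <= B & C <= B.
  exists (`|C| + 1); first by rewrite lerDr.
  by apply: le_trans (ler_norm _) _; rewrite lerDl.
have B_gt0 : 0 < B by exact: lt_le_trans B1.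
have Q_gt0 : 0 < 2 * B * k * C1 by rewrite !mulr_gt0.
pose r := Num.min 1 (Num.min r0 (2 * B * k * C1)^-1).
have r_gt0 : 0 < r by rewrite !lt_min ltr01 r0_gt0 invr_gt0.
have r1 : r <= 1 by rewrite ge_min lexx.
have rr0 : r <= r0 by rewrite !ge_min lexx orbT.
have rQ : r * (2 * B * k * C1) <= 1.
  by rewrite -ler_pdivlMr // div1r !ge_min lexx !orbT.
have kC1 : 0 < k * C1 by rewrite mulr_gt0.
have rk : 2 * (k * C1) * r <= 1.
  by apply: le_trans rQ; rewrite -!mulrA; have := mulr_gt0 kC1 r_gt0; nra.
pose K := k * r; pose J := k ^+ 2 / 2.
have K_gt0 : 0 < K by rewrite mulr_gt0.
have J_gt0 : 0 < J by rewrite divr_gt0 // exprn_gt0.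
have r01 : 0 < r <= 1 by rewrite r_gt0.
have mu_gt0 : 0 < r ^+ 2 / 2 by rewrite divr_gt0 // exprn_gt0.
have [e1 e1_gt0 e1P] := w_min (ltW P_gt0) (ltW K_gt0) (ltW J_gt0) r01 mu_gt0.
pose s := r ^+ 2 / (8 * B); have s_gt0 : 0 < s by rewrite divr_gt0 ?exprn_gt0 ?mulr_gt0.
have sB : 8 * (s * B) = r ^+ 2 by rewrite /s; field; rewrite gt_eqF.
have s_mu : 8 * s <= r ^+ 2 by rewrite -sB; have := s_gt0; nra.
have r2r : r ^+ 2 <= r by rewrite expr2 ler_piMl // ltW.
pose W := 1 + K * P + J * P ^+ 2.
have W_gt0 : 0 < W by rewrite /W -addrA ltr_pwDl // addr_ge0 // mulr_ge0 ?sqr_ge0 // ltW.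
(* Up to distance [r <= 1] the penalty is at most [W] times the distance to [x0], hence at most [s]
   within [r']. Points farther than [r'] from the boundary are covered by the radial penalty. *)
pose r' := Num.min r (s / W).
have r'_gt0 : 0 < r' by rewrite lt_min r_gt0 divr_gt0.
have r'1 : 0 < r' <= 1 by rewrite r'_gt0 ge_min r1.
have [e2 e2_gt0 e2P] := lower_bound_away_from_boundary r'1.
exists (Num.min e2 (e1 * s)); first by rewrite lt_min e2_gt0 mulr_gt0.
move=> z Oz; have [far|] := pselect (forall y, boundary O y -> r' <= enorm (y - z)).
  by rewrite ge_min e2P.
move=> /existsNP[x0 /not_implyP[bdx0 /negP]]; rewrite -ltNge => near0.
have zx0 : enorm (z - x0) < r' by rewrite -enormN opprB.
rewrite leNgt; apply/negP; rewrite lt_min => /andP[_ wz].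
have [p pP pH] := field x0 bdx0.
have [zr zW] : enorm (z - x0) < r /\ enorm (z - x0) * W < s.
  by move: zx0; rewrite lt_min ltr_pdivlMr // => /andP[].
have pen_z : penalty x0 p K J z <= s.
  apply: le_trans (ltW zW); rewrite /penalty -sqr_enorm /W.
  have d0 := enorm_ge0 (z - x0).
  have dP : `|dotv (z - x0) p| <= enorm (z - x0) * P.
    by apply: le_trans (cauchy_schwarz _ _) _; rewrite ler_wpM2l.
  have d1 : enorm (z - x0) ^+ 2 <= enorm (z - x0).
    by rewrite expr2 ler_piMl // (le_trans (ltW zr)).
  have t1 : - (K * dotv (z - x0) p) <= K * (enorm (z - x0) * P).
    rewrite -mulrN ler_wpM2l ?(ltW K_gt0) //; apply: le_trans dP.
    by rewrite lerNl; move: (lexx `|dotv (z - x0) p|); rewrite {1}ler_norml => /andP[].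
  have t2 : J * dotv (z - x0) p ^+ 2 <= J * (enorm (z - x0) * P ^+ 2).
    rewrite ler_wpM2l ?(ltW J_gt0) // -(real_normK (num_real (dotv _ _))).
    apply: (@le_trans _ _ ((enorm (z - x0) * P) ^+ 2)).
      by rewrite ler_sqr ?nnegrE // mulr_ge0 // ltW.
    by rewrite exprMn ler_wpM2r ?sqr_ge0.
  lra.
have [|||y [bdy yr ymin]] := e1P e1 x0 p z _ pP Oz (ltW zr).
- by rewrite e1_gt0 lexx.
- move=> x xr; rewrite /penalty -sqr_enorm xr /K /J.
  have := sqr_ge0 (k * dotv (x - x0) p - r); lra.
- have := ler_wpM2l (ltW e1_gt0) pen_z; have := ler_wpM2l (ltW e1_gt0) s_mu.
  have := mulr_gt0 e1_gt0 s_gt0; lra.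
have grad_le := boundary_min_gradient bdy yr ymin.
have [sy py] := pH y bdy (lt_le_trans yr rr0).
have val_le := ymin z (subset_closure Oz) (ltW zr).
pose q := dotv (y - x0) p; pose v := dotv p (N y).
have qr : `|q| <= C1 * r ^+ 2.
  apply: le_trans sy _; rewrite ler_wpM2l ?(ltW C1_gt0) //.
  by rewrite ler_sqr ?nnegrE ?enorm_ge0 ?(ltW r_gt0) // ltW.
have kq : 2 * (k * q) <= r.
  apply: (@le_trans _ _ (2 * (k * (C1 * r ^+ 2)))).
    rewrite ler_wpM2l // ler_wpM2l ?(ltW k_gt0) //.
    exact: le_trans (ler_norm _) qr.
  have := ler_wpM2r (ltW r_gt0) rk; lra.
have Nyr : - (`|L| * r) <= dotv (N y) (y - x0).
  suff : `|dotv (N y) (y - x0)| <= `|L| * r by rewrite ler_norml => /andP[].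
  apply: le_trans (cauchy_schwarz _ _) _; rewrite ler_pM ?enorm_ge0 //.
    exact: le_trans (N_bounded bdy) (ler_norm _).
  exact: ltW.
(* Since [q] is of order [r^2] at boundary points, [K - 2 J q >= K / 2]; the correction from [J]
   costs at most half of the linear term. *)
have grad_ge : r <= dotv (N y) (penalty_grad x0 p K J y).
  rewrite dotvDr !dotvZr -/q (dotvC (N y) p) -/v /K /J.
  have h1 : k * r / 2 <= k * r - 2 * (k ^+ 2 / 2) * q.
    by have := ler_wpM2l (ltW k_gt0) kq; lra.
  have h2 : a1 * (k * r / 2) <= (k * r - 2 * (k ^+ 2 / 2) * q) * - v.
    rewrite mulrC ler_pM ?(ltW a1_gt0) //; last by move: py; rewrite /v; lra.
    by rewrite divr_ge0 // ltW // mulr_gt0.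
  have h3 : a1 * (k * r / 2) = (2 * `|L| + 1) * r.
    by have := congr1 (fun u => u * r / 2) ka1; lra.
  lra.
have pen_y : - (k * C1 * r ^+ 3) <= penalty x0 p K J y.
  rewrite /penalty -/q.
  have : K * q <= K * (C1 * r ^+ 2).
    by rewrite ler_wpM2l ?(ltW K_gt0) //; exact: le_trans (ler_norm _) qr.
  rewrite /K; have := dotv_ge0 (y - x0); have := mulr_ge0 (ltW J_gt0) (sqr_ge0 q); lra.
have wy0 : 0 <= w y by apply: w_ge0; case: bdy.
have wyB : e1 * r <= B * w y.
  apply: le_trans (ler_wpM2l (ltW e1_gt0) grad_ge) _; apply: le_trans grad_le _.
  by rewrite ler_wpM2r.
have wy_le : w y < e1 * (2 * s + k * C1 * r ^+ 3).
  have := ler_wpM2l (ltW e1_gt0) pen_z; have := ler_wpM2l (ltW e1_gt0) pen_y; lra.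
(* The gradient condition [e1 r <= B w(y)] meets the upper bound on [w(y)] from comparison with [z].
   By the choice of [s] and [r] this becomes [r < r^2 / 4 + r / 2], impossible for [r <= 1]. *)
have : e1 * r < e1 * (B * (2 * s + k * C1 * r ^+ 3)).
  apply: le_lt_trans wyB _; rewrite (mulrCA e1) ltr_pM2l //.
rewrite ltr_pM2l // => lt.
have : B * (k * C1 * r ^+ 3) <= r / 2.
  have := ler_wpM2r (sqr_ge0 r) rQ.
  have -> : r * (2 * B * k * C1) * r ^+ 2 = 2 * (B * (k * C1 * r ^+ 3)) by ring.
  lra.
move: lt; rewrite mulrDr; have -> : B * (2 * s) = r ^+ 2 / 4 by rewrite -sB; field.
have := r_gt0; lra.
Qed.

End LowerBounds.

(** * Comparison *)

Section Comparison.
Context {R : realType}.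

Lemma uniform_bound {I : finType} (P : I -> R -> Prop) :
    (forall i M M', P i M -> M <= M' -> P i M') -> (forall i, exists M, P i M) ->
  exists M, forall i, P i M.
Proof.
move=> Pmono /choice[f fP]; exists (\sum_i `|f i|) => i; apply: Pmono (fP i) _.
apply: le_trans (ler_norm _) _; rewrite (bigD1 i) //= lerDl.
exact: sumr_ge0.
Qed.

Lemma closure_ge {n} (O : set 'rV[R]_n) (f : 'rV[R]_n -> R) k :
    {within closure O, continuous f} ->
  (forall x, O x -> k <= f x) -> forall x, closure O x -> k <= f x.
Proof.
move=> fc fk x clOx; rewrite leNgt; apply/negP => lt.
have e_gt0 : 0 < k - f x by rewrite subr_gt0.
have [d d_gt0 dP] := (within_continuous_enorm _ _).1 fc x clOx _ e_gt0.
have [y Oy yd] := closure_enorm clOx d_gt0.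
have := dP y (subset_closure Oy) yd; rewrite ltr_norml => /andP[_].
by have := fk y Oy; lra.
Qed.

(** Ellipticity is needed at boundary points, where it makes the conormal direction oblique; it
    passes to the limit by continuity of [A]. *)
Lemma elliptic_closure {n} (O : set 'rV[R]_n) (A : 'rV[R]_n -> 'M[R]_n) a0 :
    (forall i j, {within closure O, continuous (fun x => A x i j)}) ->
    (forall x, O x -> forall v : 'rV[R]_n, a0 * dotv v v <= dotv v (v *m A x)) ->
  forall x, closure O x -> forall v : 'rV[R]_n, a0 * dotv v v <= dotv v (v *m A x).
Proof.
move=> Ac Aell x clOx v; move: x clOx.
apply: closure_ge => [|x Ox]; last exact: Aell.
rewrite (_ : (fun x => _) = (fun x => \sum_j v 0 j * \sum_i v 0 i * A x i j)).
  by apply: within_continuous_lin => j; apply: within_continuous_lin => i.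
by apply/funext => x; apply: eq_bigr => j _; rewrite mxE.
Qed.

Lemma enorm_le {n} (v : 'rV[R]_n) k : 0 <= k -> (forall i, `|v 0 i| <= k) ->
  enorm v <= n%:R * k.
Proof.
move=> k0 vk; rewrite -ler_sqr ?nnegrE ?enorm_ge0 ?mulr_ge0 // sqr_enorm.
apply: (@le_trans _ _ (n%:R * k ^+ 2)).
  apply: ler_sum_const => i; rewrite -expr2 -(real_normK (num_real (v 0 i))).
  by rewrite ler_sqr ?nnegrE.
rewrite exprMn ler_wpM2r ?sqr_ge0 // -natrX ler_nat -[leqLHS]mul1n.
by case: (n) => // m; rewrite leq_mul2r.
Qed.

Lemma dotv_flux {n} (O : set 'rV[R]_n.+1) A u x (v : 'rV[R]_n.+1) :
  dotv v (flux O A u x) = \sum_i (v *m A x) 0 i * pd O i u x.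
Proof.
rewrite dotvE /flux trmxK mulmxA mxE; apply: eq_bigr => i _.
by rewrite [_^T _ _]mxE [grad _ _ _ _ _]mxE.
Qed.

Lemma Ck2_data {n} (O : set 'rV[R]_n) u : Ck 2 O u ->
  C2_data O u (fun i => pd O i u) (fun i j => pd O j (pd O i u)).
Proof.
move=> u2; split=> [|i]; first exact: (@Ck_C1_data _ _ 2 O u [::] u2 isT).
exact: (@Ck_C1_data _ _ 2 O u [:: i] u2 isT).
Qed.

Lemma within_continuousB {n} (S : set 'rV[R]_n) (k : R) (f g : 'rV[R]_n -> R) :
    {within S, continuous f} -> {within S, continuous g} ->
  {within S, continuous (fun x => k * f x - g x)}.
Proof.
move=> fc gc; apply/subspace_continuousP => x Sx.
have /subspace_continuousP/(_ x Sx) fx := fc.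
have /subspace_continuousP/(_ x Sx) gx := gc.
by apply: cvgB => //; exact: cvgMl_tmp.
Qed.

Lemma C1_dataB {n} (O : set 'rV[R]_n) (k : R) (f g : 'rV[R]_n -> R) F G :
  C1_data O f F -> C1_data O g G ->
  C1_data O (fun x => k * f x - g x) (fun i x => k * F i x - G i x).
Proof.
move=> [fF Fc] [gG Gc]; split=> [i x Ox|i]; last exact: within_continuousB.
exact: is_deriveB (is_deriveZ k (fF i x Ox)) (gG i x Ox).
Qed.

Lemma robin_combination (k Sv Su g vy uy : R) : 0 < k ->
  Su + g * uy <= 0 -> 0 <= Sv + g * vy -> 0 <= k * Sv - Su + g * (k * vy - uy).
Proof. by move=> /ltW k0 hu /(mulr_ge0 k0); lra. Qed.

(** The difference [w = k v - u] satisfies [L w >= k lam m], so its penalized minima lie on the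
    boundary, and the boundary condition then bounds [w] away from 0. *)
Lemma strict_comparison {n} (alpha : R) (O : set 'rV[R]_n.+1)
    (A : 'rV[R]_n.+1 -> 'M[R]_n.+1) B c bc (lam m k : R) u v :
    is_domain O -> symmetric_posdef O A -> uniformly_C2_domain O ->
    uniform_coefficients alpha O A B c -> uniform_boundary alpha O bc ->
    0 < lam -> 0 < m -> 0 < k -> (forall x, O x -> m <= v x) ->
    subsolution alpha O (elliptic_op O A B c) (boundary_op O A bc) u ->
    supersolution alpha O (shift_op (elliptic_op O A B c) lam)
      (boundary_op O A bc) v ->
    (forall x, O x -> u x <= k * v x) ->
  exists2 e, 0 < e & forall x, O x -> u x + e <= k * v x.
Proof.
move=> [_ oO _] Apos O_C2 [Au Bu cu [a0 a0_gt0 Aell]] bcu lam_gt0 m_gt0 k_gt0 vm.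
move=> [[u2 _] Lu Bdu] [[v2 _] Lv Bdv] uv.
pose w x := k * v x - u x; pose G i x := k * pd O i v x - pd O i u x.
pose H i j x := k * pd O j (pd O i v) x - pd O j (pd O i u) x.
have uc : {within closure O, continuous u} by exact: (u2 [::] isT).1.
have vc : {within closure O, continuous v} by exact: (v2 [::] isT).1.
have wc : {within closure O, continuous w} by exact: within_continuousB.
have Gc i : {within closure O, continuous (G i)}.
  by apply: within_continuousB; [exact: (v2 [:: i] isT).1|exact: (u2 [:: i] isT).1].
have wC2 : C2_data O w G H.
  have [v1 vH] := Ck2_data v2; have [u1 uH] := Ck2_data u2.
  split; first exact: (C1_dataB k v1 u1).
  by move=> i; exact: (C1_dataB k (vH i) (uH i)).
have w_ge0 : forall x, closure O x -> 0 <= w x.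
  by apply: closure_ge => // x Ox; rewrite subr_ge0 uv.
have [M [aM daM bM cM]] : exists M, [/\
    forall x, closure O x -> forall i j, `|A x i j| <= M,
    forall x, O x -> forall i j, `|pd O i (fun y => A y i j) x| <= M,
    forall x, O x -> forall i, `|B x 0 i| <= M & forall x, O x -> `|c x| <= M].
  have [||MA MAP] := @uniform_bound ('I_n.+1 * 'I_n.+1)%type (fun ij M =>
    Ck_norm_le 1 O (closure O) M (fun x => A x ij.1 ij.2)).
  - by move=> ij M M' h MM' s s1 x xO; exact: le_trans (h s s1 x xO) MM'.
  - by move=> [i j]; have [_ [M [h _]]] := Au i j; exists M.
  have [||MB MBP] := @uniform_bound 'I_n.+1 (fun i M =>
    Ck_norm_le 0 O (closure O) M (fun x => B x 0 i)).
  - by move=> i M M' h MM' s s1 x xO; exact: le_trans (h s s1 x xO) MM'.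
  - by move=> i; have [_ [M [h _]]] := Bu i; exists M.
  have [_ [Mc [McP _]]] := cu.
  exists (Num.max MA (Num.max MB Mc)).
  split=> [x clOx i j|x Ox i j|x Ox i|x Ox]; rewrite !le_max.
  - by rewrite (MAP (i, j) [::]).
  - by rewrite (MAP (i, j) [:: i] isT x (subset_closure Ox)).
  - by rewrite (MBP i [::] isT x (subset_closure Ox)) orbT.
  - by rewrite (McP [::] isT x (subset_closure Ox)) !orbT.
have A1 i j : Ck 1 O (fun x => A x i j) by case: (Au i j).
have Lw x : O x -> k * lam * m <= op_at (A x)
    (fun i j => pd O i (fun y => A y i j) x) (B x 0) (c x) (w x)
    (fun i => G i x) (fun i j => H i j x).
  move=> Ox; rewrite op_at_lin -!elliptic_opE //.
  have := Lv x Ox; rewrite /shift_op subr_ge0 => Lvx.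
  have h1 := ler_wpM2l (ltW k_gt0) (le_trans (ler_wpM2l (ltW lam_gt0) (vm x Ox)) Lvx).
  by have := Lu x Ox; lra.
have w_min : minima_at_boundary O w.
  apply: (@penalized_boundary_min R n O w G H (fun x => A x)
    (fun x i j => pd O i (fun y => A y i j) x) (fun x => B x 0) c M (k * lam * m)) => //.
  - by move=> x Ox i j; have [At _] := Apos x Ox; rewrite -[in LHS]At mxE.
  - move=> x Ox y [i yi]; have [_ Ax] := Apos x Ox.
    have -> : qform (A x) y = dotv (\row_i y i) ((\row_i y i) *m A x).
      rewrite /qform exchange_big; apply: eq_bigr => j _ /=.
      rewrite !mxE mulr_sumr; apply: eq_bigr => l _; rewrite !mxE; ring.
    by apply: Ax; apply: contra yi => /eqP/rowP/(_ i); rewrite !mxE => ->.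
  - by move=> x Ox; exact: aM (subset_closure Ox).
  - by rewrite !mulr_gt0.
suff [e e_gt0 eP] : exists2 e, 0 < e & forall x, O x -> e <= w x.
  by exists e => // x /eP; rewrite /w; lra.
case: bc bcu Bdu Bdv => [_|gamma [C [gC _]]] /= Bdu Bdv.
  apply: (@lower_bound_of_boundary R n O w w_min (k * m)); first exact: mulr_gt0.
  move=> y bdy; have vmy := closure_ge vc vm (let: conj h _ := bdy in h).
  by have := ler_wpM2l (ltW k_gt0) vmy; have := Bdu y bdy; rewrite /w; lra.
(* [outer_normal] falls back to 0 if no normal exists; the uniform charts provide one. *)
have nuP y : boundary O y -> is_outer_normal O y (outer_normal O y).
  move=> bdy; apply: xgetPex; have [r [C' [_ _ /(_ y bdy)[Q [g [chart g2 _]]]]]] := O_C2.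
  by eexists; exists r, Q, g; split=> //; exact: Ck_le g2.
have Ac i j : {within closure O, continuous (fun x => A x i j)}.
  exact: (A1 i j [::] isT).1.
have Acl := elliptic_closure Ac Aell.
have nu1 y : boundary O y -> enorm (outer_normal O y) = 1.
  by move=> bdy; have [] := outer_normal_spec bdy (nuP y bdy).
(* The oblique direction is the conormal [nu A]; ellipticity gives [nu A . nu >= a0], and
   boundedness of [A] bounds its length. *)
apply: (@lower_bound_oblique R n O w w_min G (outer_normal O)
  (fun y => outer_normal O y *m A y) gamma a0 (n.+1%:R * (n.+1%:R * M)) C) => //.
- by case: wC2.
- move=> y bdy; rewrite dotvC; have := Acl y (let: conj h _ := bdy in h) (outer_normal O y).
  by rewrite -sqr_enorm nu1 // expr1n mulr1.
- move=> y bdy; have clOy : closure O y by case: bdy.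
  have M0 : 0 <= M by exact: le_trans (aM y clOy 0 0).
  apply: enorm_le => [|i]; first by rewrite mulr_ge0.
  rewrite mxE; apply: norm_sum_le => j; rewrite normrM -[leRHS]mul1r ler_pM //.
    by rewrite -(nu1 y bdy) coord_le_enorm.
  exact: aM.
- move=> y bdy; have hv := Bdv y bdy; have hu := Bdu y bdy.
  rewrite (dotv_flux O A v y) in hv; rewrite (dotv_flux O A u y) in hu.
  have -> : \sum_i (outer_normal O y *m A y) 0 i * G i y =
      k * (\sum_i (outer_normal O y *m A y) 0 i * pd O i v y)
      - \sum_i (outer_normal O y *m A y) 0 i * pd O i u y.
    rewrite mulr_sumr -sumrB; apply: eq_bigr => i _.
    by rewrite /G mulrBr mulrCA.
  exact: robin_combination k_gt0 hu hv.
Qed.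

End Comparison.

(** * The Maximum Principle, by lowering the constant [k] in [u <= k v] *)

Theorem theorem3 (R : realType) (n : nat) (alpha : R)
    (Omega : set 'rV[R]_n.+1)
    (A : 'rV[R]_n.+1 -> 'M[R]_n.+1) (B : 'rV[R]_n.+1 -> 'rV[R]_n.+1)
    (c : 'rV[R]_n.+1 -> R) (bc : boundary_condition R n)
    (alpha_gt0 : 0 < alpha) (alpha_lt1 : alpha < 1)
    (Omega_domain : is_domain Omega)
    (Omega_regular : loc_regular_domain alpha Omega)
    (coef_standing : standing_coefficients alpha Omega A B c)
    (bc_standing : standing_boundary alpha Omega bc)
    (Omega_C2 : uniformly_C2_domain Omega)
    (coef_uniform : uniform_coefficients alpha Omega A B c)
    (bc_uniform : uniform_boundary alpha Omega bc) :
  let L := elliptic_op Omega A B c in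
  let Bd := boundary_op Omega A bc in
  (0 < tilde_lambda1 alpha Omega L Bd)%E ->
  maximum_principle alpha Omega L Bd.
Proof.
move=> L Bd /ereal_sup_gt[_ [lam [v [vsup vinf]] <-]]; rewrite lte_fin => lam_gt0.
move=> u usub usup x1 Ox1; rewrite leNgt; apply/negP => u1_gt0.
have [m m_gt0 vm] : exists2 m, 0 < m & forall x, Omega x -> m <= v x.
  have lb x : Omega x -> (ereal_inf [set (v y)%:E | y in Omega] <= (v x)%:E)%E.
    by move=> Ox; apply: ereal_inf_lbound; exists x.
  (* The infimum is not [+oo], since it is at most the finite value [v x1]. *)
  move: vinf lb; case: (ereal_inf _) => [m|_ /(_ x1 Ox1)|] //=.
  by rewrite lte_fin => m_gt0 lb; exists m => // x /lb; rewrite lee_fin.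
have [U uU] : exists U, forall x, Omega x -> u x <= U.
  have ub x : Omega x -> ((u x)%:E <= ereal_sup [set (u y)%:E | y in Omega])%E.
    by move=> Ox; apply: ereal_sup_ubound; exists x.
  move: usup ub; case: (ereal_sup _) => [U _ ub||_ /(_ x1 Ox1)] //=.
  by exists U => x /ub; rewrite lee_fin.
have U_gt0 : 0 < U by exact: lt_le_trans (uU x1 Ox1).
have v_gt0 x : Omega x -> 0 < v x by move=> /vm; exact: lt_le_trans.
pose S := [set u x / v x | x in Omega].
have supS : has_sup S.
  split; first by exists (u x1 / v x1), x1.
  exists (U / m) => _ [x Ox <-]; rewrite ler_pdivrMr ?v_gt0 // mulrAC ler_pdivlMr //.
  apply: (@le_trans _ _ (U * m)); first by rewrite ler_wpM2r ?uU // ltW.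
  by rewrite ler_wpM2l ?vm // ltW.
pose k := sup S.
have uk x : Omega x -> u x <= k * v x.
  by move=> Ox; rewrite -ler_pdivrMr ?v_gt0 //; apply: sup_upper_bound => //; exists x.
have k_gt0 : 0 < k.
  have := lt_le_trans u1_gt0 (uk x1 Ox1); rewrite pmulr_lgt0 //; exact: v_gt0.
have [_ _ _ Apos] := coef_standing.
have [e e_gt0 eP] := strict_comparison Omega_domain Apos Omega_C2 coef_uniform
  bc_uniform lam_gt0 m_gt0 k_gt0 vm usub vsup uk.
(* At a point where [u > (k - d) v], the bound [d <= k / 2] gives [k v <= 2 U], while [u + e <= k v]
   gives [e < d v]. The second bound on [d] then yields [d v <= e / 2], a contradiction. *)
pose d := Num.min (k / 2) (k * e / (4 * U)).
have d_gt0 : 0 < d by rewrite lt_min !divr_gt0 ?mulr_gt0.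
have [_ [x Ox <-]] := sup_adherent d_gt0 supS.
rewrite -/k ltr_pdivlMr ?v_gt0 // => kd.
have dk : d <= k / 2 by rewrite ge_min lexx.
have de : d * (4 * U) <= k * e by rewrite -ler_pdivlMr ?mulr_gt0 // ge_min lexx orbT.
have kv : k * v x <= 2 * U.
  have := ler_wpM2r (ltW (v_gt0 x Ox)) dk; have := uU x Ox; lra.
have edv : e < d * v x by have := eP x Ox; lra.
have h1 := ler_wpM2l (ltW d_gt0) kv.
have h2 : k * e < k * (d * v x) by rewrite ltr_pM2l.
have := mulr_gt0 k_gt0 e_gt0; lra.
Qed.
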